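(* Let $f\in\mathcal{F}(\mathbb{R}^n)$ be such that $\Vert f\Vert_\infty=f(0)$. Then $$ n\int_0^\infty r^{n-1}\int_{\mathbb{R}^n}\min\{f(z),f(z-re_n)\}\,d\mu(z)\,dr\leq n!\,\frac{\left(\int_{\mathbb{R}^n}(S_{e_n}(f)\star\chi_{C_{n-1}})(x)\,d\mu(x)\right)^{n+1}}{\left(\int_{e_n^\perp}P_{e_n^\perp}f(y)\,dG_{n-1}(y)\right)^n}. $$
   Context: A function $f:\mathbb{R}^n\to[0,\infty)$ is log-concave if $f=e^{-u}$ with $u:\mathbb{R}^n\to(-\infty,\infty]$ convex (with $e^{-\infty}=0$). $\mathcal{F}(\mathbb{R}^n)$ is the set of Lebesgue-integrable log-concave functions on $\mathbb{R}^n$ with positive integral; $\Vert f\Vert_\infty=\sup f$. $(e_i)_{i=1}^n$ is the canonical basis of $\mathbb{R}^n$, $e_n^\perp$ is the hyperplane orthogonal to $e_n$ (identified with $\mathbb{R}^{n-1}$), and $\langle e_n\rangle$ is the line spanned by $e_n$. Measures: $G_{n-1}$ is the lattice point enumerator on $e_n^\perp\cong\mathbb{R}^{n-1}$, $G_{n-1}(A)=\#(A\cap\mathbb{Z}^{n-1})$. $\mu$ is the measure on $\mathbb{R}^n=\mathbb{R}^{n-1}\times\mathbb{R}$ given by $d\mu=dG_{n-1}\otimes dm_1$, where $m_1$ is one-dimensional Lebesgue measure. $P_{e_n^\perp}f:e_n^\perp\to[0,\infty)$ is $P_{e_n^\perp}f(y)=\sup_{\lambda\in\mathbb{R}}f(y+\lambda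 e_n)$. $C_{n-1}=(-1,1)^{n-1}\times\{0\}\subseteq\mathbb{R}^n$, and $\chi_A$ is the characteristic function of $A$. The Asplund product is $(f\star g)(x)=\sup_{z\in\mathbb{R}^n}f(z)g(x-z)$. Steiner symmetrization: for a bounded convex set $K\subseteq\mathbb{R}^n$, with $P_{e_n^\perp}(K)$ its orthogonal projection onto $e_n^\perp$, $$S_{e_n}(K)=\left\{y+\tfrac{t_1-t_2}{2}e_n : y\in P_{e_n^\perp}(K),\ y+t_1e_n\in K,\ y+t_2e_n\in K\right\}.$$ For $f\in\mathcal{F}(\mathbb{R}^n)$ and $t\ge 0$ let $L_t(f)=\{x\in\mathbb{R}^n: f(x)\geq e^{-t}\Vert f\Vert_\infty\}$, which is a bounded convex set. The Steiner symmetrization of $f$ with respect to $e_n^\perp$ is $S_{e_n}(f)(x)=\Vert f\Vert_\infty e^{-\tilde u(x)}$, where $\tilde u(x)=\inf\{t\geq 0: x\in S_{e_n}(L_t(f))\}$ (with $\inf\emptyset=\infty$). *)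

(* Defs.v *)
From HB Require Import structures.
From mathcomp Require Import all_boot all_order all_algebra.
From mathcomp Require Import all_classical all_reals all_analysis.

Set Implicit Arguments.
Unset Strict Implicit.
Unset Printing Implicit Defensive.

Import Order.TTheory GRing.Theory Num.Theory.
Import numFieldNormedType.Exports.

Local Open Scope classical_set_scope.
Local Open Scope ring_scope.
Local Open Scope ereal_scope.

(* Points of R^n are row vectors; the sigma-algebra generated by the
   coordinates is the Borel sigma-algebra of R^n. *)
Section measurable_rV.
Context (R : realType) (n : nat).

Definition coordinate (i : 'I_n) (x : 'rV[R]_n) : measurableTypeR R := x ord0 i.

Let rV_set0 : g_sigma_preimage coordinate set0.
Proof. exact: sigma_algebra0. Qed.

Let rV_setC A : g_sigma_preimage coordinate A ->
  g_sigma_preimage coordinate (~` A).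
Proof. exact: sigma_algebraC. Qed.

Let rV_bigcup (F : (set 'rV[R]_n)^nat) :
  (forall i, g_sigma_preimage coordinate (F i)) ->
  g_sigma_preimage coordinate (\bigcup_i F i).
Proof. exact: sigma_algebra_bigcup. Qed.

HB.instance Definition _ := @isMeasurable.Build default_measure_display
  'rV[R]_n (g_sigma_preimage coordinate) rV_set0 rV_setC rV_bigcup.

Lemma measurable_coordinate (i : 'I_n) :
  measurable_fun [set: 'rV[R]_n] (coordinate i).
Proof.
move=> _ Y mY; rewrite setTI; apply: sub_sigma_algebra => /=.
rewrite -bigcup_seq/=; exists i => /=; first by rewrite mem_index_enum.
by exists Y => //; rewrite setTI.
Qed.

Lemma measurable_fun_rV d (T : measurableType d) (f : T -> 'rV[R]_n) :
  (forall i, measurable_fun [set: T] (coordinate i \o f)) ->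
  measurable_fun [set: T] f.
Proof.
move=> mf _ A mA; rewrite setTI.
have : <<s \big[setU/set0]_(i < n)
    preimage_set_system setT (coordinate i) measurable >> A by [].
apply: (@smallest_sub _ _ _ [set B | measurable (f @^-1` B)]).
  split => /=.
  - by rewrite preimage_set0.
  - by move=> B mB; rewrite setTD preimage_setC; exact: measurableC.
  - by move=> F mF; rewrite preimage_bigcup; exact: bigcup_measurable.
rewrite -bigcup_seq; apply: bigcup_sub => i _ B [C mC <-] /=.
by rewrite setTI -comp_preimage -[X in measurable X]setTI; exact: mf.
Qed.

End measurable_rV.

(* Throughout, n = m.+1, so that n.-1 = m: the hyperplane e_n^\perp of
   R^m.+1 is identified with R^m. *)
Section hyperplane.
Context {R : realType} {m : nat}.

Definition e_last : 'rV[R]_m.+1 := delta_mx ord0 ord_max.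

Definition to_hyperplane (y : 'rV[R]_m) : 'rV[R]_m.+1 :=
  \row_i (if unlift ord_max i is Some j then y ord0 j else 0%R).

Definition proj_hyperplane (x : 'rV[R]_m.+1) : 'rV[R]_m :=
  \row_j x ord0 (lift ord_max j).

Definition glue (p : 'rV[R]_m * measurableTypeR R) : 'rV[R]_m.+1 :=
  (to_hyperplane p.1 + (p.2 : R) *: e_last)%R.

Lemma measurable_glue : measurable_fun setT glue.
Proof.
apply: measurable_fun_rV => i; case: (unliftP ord_max i) => [j|] ->.
- rewrite (_ : _ \o _ = coordinate j \o fst).
    exact: measurableT_comp (measurable_coordinate j) measurable_fst.
  apply/funext => p /=; rewrite /coordinate /glue /e_last !mxE liftK eqxx /=.
  by rewrite eq_sym (negbTE (neq_lift _ _)) mulr0 addr0.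
- rewrite (_ : _ \o _ = snd); first exact: measurable_snd.
  apply/funext => p /=; rewrite /coordinate /glue /e_last !mxE unlift_none.
  by rewrite !eqxx mulr1 add0r.
Qed.

(* nu \otimes m_1 on R^m.+1 = R^m x R *)
Definition prod_line (nu : {measure set 'rV[R]_m -> \bar R}) :
    set 'rV[R]_m.+1 -> \bar R :=
  pushforward (nu \x (@lebesgue_measure R)) glue.

Section prod_line_measure.
Variable nu : {measure set 'rV[R]_m -> \bar R}.

Let prod_line0 : prod_line nu set0 = 0.
Proof. by rewrite /prod_line /pushforward preimage_set0 measure0. Qed.

Let prod_line_ge0 A : 0 <= prod_line nu A.
Proof. exact: (@measure_ge0 _ _ _ (nu \x (@lebesgue_measure R))). Qed.

Let prod_line_sigma_additive : semi_sigma_additive (prod_line nu).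
Proof.
move=> F mF tF mUF; rewrite /prod_line /pushforward preimage_bigcup.
apply: (@measure_semi_sigma_additive _ _ _ (nu \x (@lebesgue_measure R))).
- by move=> n; rewrite -[X in measurable X]setTI; exact: measurable_glue.
- apply/trivIsetP => /= i j _ _ ij; rewrite -preimage_setI.
  by move/trivIsetP : tF => /(_ _ _ _ _ ij) ->//; rewrite preimage_set0.
- rewrite -preimage_bigcup -[X in measurable X]setTI.
  exact: measurable_glue.
Qed.

HB.instance Definition _ := isMeasure.Build _ _ _ (prod_line nu)
  prod_line0 prod_line_ge0 prod_line_sigma_additive.

End prod_line_measure.
End hyperplane.
Arguments e_last {R} m.

Section measures.
Context (R : realType).

Fixpoint lebesgue_borel (n : nat) : {measure set 'rV[R]_n -> \bar R} :=
  match n with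
  | 0%N => \d_(0%R : 'rV[R]_0)
  | m.+1 => prod_line (lebesgue_borel m)
  end.

(* Completed, so that every Lebesgue measurable function is measurable:
   log-concave functions need not be Borel. *)
Definition lebesgue (n : nat) :
    {measure set (caratheodory_type (lebesgue_borel n)^*%mu) -> \bar R} :=
  @completed_measure_extension _ _ _ (lebesgue_borel n).

Definition integer_lattice (m : nat) : set 'rV[R]_m :=
  [set y | forall j, y ord0 j \is a Num.int].
Arguments integer_lattice : clear implicits.

Lemma measurable_integer_lattice m : measurable (integer_lattice m).
Proof.
have -> : integer_lattice m =
    \bigcap_(j in [set: 'I_m]) (coordinate j @^-1` [set t : R | t \is a Num.int]).
  by apply/seteqP; split => [y h j _|y h j]; [exact: h|exact: h].
apply: fin_bigcap_measurable => // j _.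
rewrite -[X in measurable X]setTI; apply: measurable_coordinate => //.
apply: countable_measurable; first exact: measurable_set1.
rewrite (_ : [set t | _] = range (fun k : int => k%:~R)).
  exact: (card_le_trans (card_image_le _ _) (countableP _)).
by apply/seteqP; split => [t /intrP[k ->]|_ [k _ <-]] /=; [exists k|].
Qed.

Definition lattice_count (m : nat) : {measure set 'rV[R]_m -> \bar R} :=
  mrestr (@counting _ R) (@measurable_integer_lattice m).

Definition mu (m : nat) : {measure set 'rV[R]_m.+1 -> \bar R} :=
  prod_line (lattice_count m).

End measures.

Section functions.
Context {R : realType}.

Definition convex_ereal {V : lmodType R} (u : V -> \bar R) :=
  forall (x y : V) (t : R), (0 <= t <= 1)%R ->
    u ((1 - t) *: x + t *: y)%R <= (1 - t)%:E * u x + t%:E * u y.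

Definition log_concave {V : lmodType R} (f : V -> R) :=
  exists u : V -> \bar R,
    [/\ forall x, u x != -oo, convex_ereal u &
        forall x, (f x)%:E = expeR (- u x)].

Definition integrable_log_concave (n : nat) (f : 'rV[R]_n -> R) :=
  [/\ log_concave f, (lebesgue R n).-integrable setT (EFin \o f) &
      0 < \int[lebesgue R n]_x (f x)%:E].

(* Suprema are taken in \bar R, so that they are the genuine ones whether or
   not the function is bounded. *)
Definition supnorm {T : Type} (f : T -> R) : \bar R :=
  ereal_sup [set (f x)%:E | x in setT].

Definition asplund {V : zmodType} (f g : V -> \bar R) (x : V) : \bar R :=
  ereal_sup [set f z * g (x - z)%R | z in setT].

Context {m : nat}.
Implicit Types (K : set 'rV[R]_m.+1) (f : 'rV[R]_m.+1 -> R).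

Definition proj_fun f (y : 'rV[R]_m) : \bar R :=
  ereal_sup [set (f (to_hyperplane y + l *: e_last m)%R)%:E | l in [set: R]].

Definition cube : set 'rV[R]_m.+1 :=
  [set to_hyperplane y |
    y in [set y : 'rV[R]_m | forall j, (-1 < y ord0 j < 1)%R]].

Definition steiner_set K : set 'rV[R]_m.+1 :=
  [set x | exists y t1 t2,
    [/\ (proj_hyperplane @` K) y,
        K (to_hyperplane y + t1 *: e_last m)%R,
        K (to_hyperplane y + t2 *: e_last m)%R &
        x = (to_hyperplane y + ((t1 - t2) / 2) *: e_last m)%R]].

Definition superlevel f (t : R) : set 'rV[R]_m.+1 :=
  [set x | (expR (- t))%:E * supnorm f <= (f x)%:E].

Definition steiner_exponent f (x : 'rV[R]_m.+1) : \bar R :=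
  ereal_inf [set t%:E |
    t in [set t : R | (0 <= t)%R /\ steiner_set (superlevel f t) x]].

Definition steiner f (x : 'rV[R]_m.+1) : \bar R :=
  supnorm f * expeR (- steiner_exponent f x).

End functions.
Arguments cube {R} m.

(* Main.v *)
(* On each line y + R e_n, put g(y, r) = sup_t min(f(y, t + r), f(y, t)), which
   is log-concave in (y, r) for r >= 0, and let F(r) be the sum of g(y, r) over
   the points y of Z^(n-1).  Layer cake and Tonelli bound the left-hand side by the
   integral of r^n F(r) over r >= 0, while F(0) is the integral of the projection
   of f, and S_(e_n) f(y, s) >= g(y, 2 |s|).  Let D(r) be the sum over y of the
   supremum of g(., r) on y + (-1, 1)^(n-1); its integral over r >= 0 is at most
   that of the Asplund product.  A discrete Prekopa-Leindler inequality gives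
   D(l r) >= F(0)^(1 - l) F(r)^l, and the comparison of F and D with the
   exponential of integral A > int D that has the value F(0) at 0 gives
   int r^n F(r) dr F(0)^n <= n! (int D)^(n+1), as in Borell's inequality.
   All this is done for y in the boxes {-N..N}^(n-1), before letting N grow.
   The limit is meaningful because F(0) stays bounded: f >= v > 0 on a Borel set
   of positive measure, and averaging it with each lattice line produces disjoint
   sets on which f is bounded below. *)

Require Import Defs.
From HB Require Import structures.
From mathcomp Require Import all_boot all_order all_algebra.
From mathcomp Require Import all_classical all_reals all_analysis.
From mathcomp Require Import measurable_realfun ring lra zify.

Set Implicit Arguments.
Unset Strict Implicit.
Unset Printing Implicit Defensive.

Import Order.TTheory GRing.Theory Num.Theory.
Import numFieldNormedType.Exports.

Local Open Scope classical_set_scope.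
Local Open Scope ring_scope.
Local Open Scope ereal_scope.

(** * The discrete Prekopa-Leindler inequality *)

(** Log-concave functions need not be Borel, so the integrands over [mu] may fail to be measurable,
    and their integrals are then suprema over the simple functions below. Each use of Tonelli's
    theorem therefore goes one way: an upper bound on the left-hand side, and a lower bound, by
    measurable functions carried by finitely many lattice lines, for the Asplund product. Along a
    single line everything is unimodal, hence Borel. The cube is the price of the lattice: convex
    combinations of integer points are not integer points, and rounding them moves each coordinate
    by less than 1. The factor 2 in g(y, 2 |s|) costs nothing, because s runs over both half-lines.
    F need not be log-concave, and the discrete inequality relates F to D only through segments that
    start at 0; hence the comparison with an exponential having the value F(0) there. With B = F(0),
    its rate is B / A and its n-th moment is n! A^(n+1) / B^n, the origin of n!. *)

Section sum_of_intervals.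
Context {R : realType}.
Local Open Scope ring_scope.

Lemma integral_sum_itv (I : finType) (c x y : I -> R) :
  (forall i, 0 <= c i) -> (forall i, x i <= y i) ->
  (\int[@lebesgue_measure R]_v (\sum_i c i * (x i <= v < y i)%R%:R)%:E =
   (\sum_i c i * (y i - x i))%:E)%E.
Proof.
move=> c0 xy.
pose F i v : \bar R := ((c i)%:E * (\1_(`[x i, y i[%classic : set R) v)%:E)%E.
transitivity (\int[@lebesgue_measure R]_v \sum_i F i v)%E.
  apply: eq_integral => v _; rewrite sumEFin; congr (_%:E).
  by apply: eq_bigr => i _; rewrite indicE mem_setE in_itv.
have mF i : measurable_fun setT (F i).
  by apply: measurable_funeM; apply/measurable_EFinP; exact: measurable_indic.
rewrite ge0_integral_sum//; last first.
  by move=> i v _; rewrite /F mule_ge0// lee_fin.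
rewrite -sumEFin; apply: eq_bigr => i _.
rewrite /F ge0_integralZl_EFin//; last first.
  by apply/measurable_EFinP; exact: measurable_indic.
rewrite integral_indic// setIT.
rewrite /= lebesgue_measure_itv/= lte_fin EFinM; congr (_ * _)%E.
case: ltP => // yx.
have /eqP -> : y i == x i by rewrite eq_le yx xy.
by rewrite subrr.
Qed.

(** Integration of an inequality between step functions. It serves twice: over positions on the
    line, to count integers, and over levels, as a layer cake formula for finite sums. *)
Lemma le_sum_itv (I J : finType) (c x y : I -> R) (d u w : J -> R) :
  (forall i, 0 <= c i) -> (forall i, x i <= y i) ->
  (forall j, 0 <= d j) -> (forall j, u j <= w j) ->
  (forall v, \sum_i c i * (x i <= v < y i)%R%:R <=
             \sum_j d j * (u j <= v < w j)%R%:R) ->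
  \sum_i c i * (y i - x i) <= \sum_j d j * (w j - u j).
Proof.
move=> c0 xy d0 uw le_cd; rewrite -lee_fin -!integral_sum_itv//.
have mS (K : finType) (e s t : K -> R) : measurable_fun setT
    (fun v : R => (\sum_i e i * (s i <= v < t i)%R%:R)%:E).
  apply/measurable_EFinP; apply: measurable_sum => i.
  apply: measurable_funM => //.
  rewrite (_ : (fun v => _) = \1_(`[s i, t i[%classic : set R)).
    exact: measurable_indic.
  by apply/funext => v; rewrite indicE mem_setE in_itv.
apply: ge0_le_integral => //.
- by move=> v _; rewrite lee_fin sumr_ge0// => i _; rewrite mulr_ge0.
- exact: mS.
- exact: mS.
- by move=> v _; rewrite lee_fin.
Qed.

End sum_of_intervals.

Section discrete_prekopa_leindler.
Context {R : realType}.
Variable l : R.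
Hypothesis l01 : (0 < l < 1)%R.
Local Open Scope ring_scope.

Let l0 : 0 < l. Proof. by case/andP: l01. Qed.
Let l1 : 0 < 1 - l. Proof. by rewrite subr_gt0; case/andP: l01. Qed.

Lemma sum_bool_le1 (I : finType) (P : pred I) :
  (forall i j, P i -> P j -> i = j) -> \sum_i (P i)%:R <= 1 :> R.
Proof.
move=> P1; have [/existsP[i Pi]|/existsPn P0] := boolP [exists i, P i].
  rewrite (bigD1 i)//= Pi big1 ?addr0// => j ji.
  by case: (boolP (P j)) => // /P1 /(_ Pi) ij; rewrite ij eqxx in ji.
by rewrite big1 // => i _; rewrite (negbTE (P0 _)).
Qed.

(** The strict inequality matches the open cube (-1, 1)^(n-1). *)
Definition between (x y z : R) := `|z - ((1 - l) * x + l * y)| < 1.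

(* The half-open intervals of length 1 - l based at the (1 - l) p + l min B and
   those of length l based at the (1 - l) (max A + 1) + l q are disjoint, and
   the integer part of each of their points belongs to C. *)
Lemma discrete_brunn_minkowski k (A B C : {set 'I_k}) :
  A != finset.set0 -> B != finset.set0 ->
  (forall p q r : 'I_k, p \in A -> q \in B ->
    between p%:R q%:R r%:R -> r \in C) ->
  (1 - l) * #|A|%:R + l * #|B|%:R <= #|C|%:R.
Proof.
move=> /set0Pn[a0 a0A] /set0Pn[b0 b0B] ABC; have [lgt0 llt1] := (l0, l1).
have [pm pmA pmax] := @arg_maxnP _ a0 (mem A) val a0A.
have [qm qmB qmin] := @arg_minnP _ b0 (mem B) val b0B.
have cover (p q : 'I_k) (v : R) : p \in A -> q \in B ->
    (1 - l) * p%:R + l * q%:R <= v < (1 - l) * p%:R + l * q%:R + 1 ->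
    exists2 r : 'I_k, r \in C & r%:R <= v < r%:R + 1.
  move=> pA qB /andP[wv vw].
  have w0 : 0 <= (1 - l) * p%:R + l * q%:R by rewrite addr_ge0// mulr_ge0// ltW.
  have /truncn_itv : 0 <= v by exact: le_trans wv.
  set t := Num.trunc v => /andP[tv vt].
  (* Both indices are at most k - 1, which keeps the integer part of [v] below [k]. *)
  have wk : (1 - l) * p%:R + l * q%:R + 1 <= k%:R.
    have pk : p%:R + 1 <= k%:R :> R by rewrite natr1 ler_nat.
    have qk : q%:R + 1 <= k%:R :> R by rewrite natr1 ler_nat.
    have : (1 - l) * (p%:R + 1) + l * (q%:R + 1) <= (1 - l) * k%:R + l * k%:R.
      by rewrite lerD// ler_wpM2l// ltW.
    lra.
  have tk : (t < k)%N by rewrite -(ltr_nat R); lra.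
  exists (Ordinal tk); last by rewrite /= tv natr1 vt.
  apply: (ABC p q) => //; rewrite /between /= ltr_norml.
  rewrite -natr1 in vt; lra.
(* The last interval of the first family ends at [c0], where the first interval of the second
   begins; a point [v] thus meets only one family. *)
pose c0 := (1 - l) * (pm%:R + 1) + l * qm%:R.
pose x (i : 'I_k + 'I_k) := match i with
  | inl p => (1 - l) * p%:R + l * qm%:R
  | inr q => (1 - l) * (pm%:R + 1) + l * q%:R end.
pose y (i : 'I_k + 'I_k) := match i with
  | inl p => x i + (1 - l) | inr q => x i + l end.
pose c (i : 'I_k + 'I_k) : R := match i with
  | inl p => (p \in A)%:R | inr q => (q \in B)%:R end.
have xy i : x i <= y i by case: i => i; rewrite /y lerDl ltW.
have cardE (D : {set 'I_k}) : (\sum_i (i \in D))%N = #|D|.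
  by rewrite -sum1_card [RHS]big_mkcond; apply: eq_bigr => i _; case: (i \in D).
have := @le_sum_itv R _ _ c x y (fun j : 'I_k => (j \in C)%:R)
  (fun j : 'I_k => j%:R) (fun j : 'I_k => j%:R + 1).
rewrite [X in _ -> _ -> _ -> _ -> _ -> X <= _]big_sumType /=.
have -> : \sum_p (p \in A)%:R * ((1 - l) * (p : nat)%:R + l * qm%:R + (1 - l)
     - ((1 - l) * p%:R + l * qm%:R)) = (1 - l) * #|A|%:R.
  under eq_bigr do rewrite addrAC subrr add0r.
  by rewrite -mulr_suml -natr_sum cardE mulrC.
have -> : \sum_q (q \in B)%:R * ((1 - l) * (pm%:R + 1) + l * (q : nat)%:R + l
     - ((1 - l) * (pm%:R + 1) + l * q%:R)) = l * #|B|%:R.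
  under eq_bigr do rewrite addrAC subrr add0r.
  by rewrite -mulr_suml -natr_sum cardE mulrC.
have -> : \sum_(j < k) (j \in C)%:R * (j%:R + 1 - j%:R) = #|C|%:R :> R.
  under eq_bigr do rewrite addrAC subrr add0r mulr1.
  by rewrite -natr_sum cardE.
apply => //.
- by case.
- by move=> j; rewrite lerDl.
move=> v; rewrite big_sumType /=.
have lt_unique (d z : R) (i j : 'I_k) : 0 < d < 1 ->
    d * i%:R + z <= v < d * i%:R + z + d -> d * j%:R + z <= v < d * j%:R + z + d ->
    i = j.
  move=> /andP[d0 d1] /andP[iv vi] /andP[jv vj]; apply/val_inj/eqP.
  rewrite eqn_leq -(ltnS i j) -(ltnS j i) -!(ltr_nat R) -!natr1.
  by apply/andP; split; rewrite -(ltr_pM2l d0); lra.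
have key (i : 'I_k + 'I_k) : c i = 1 -> x i <= v < y i ->
    1 <= \sum_(j < k) (j \in C)%:R * (j%:R <= v < j%:R + 1)%R%:R :> R.
  move=> ci xvy; have [r rC rv] : exists2 r : 'I_k, r \in C & r%:R <= v < r%:R + 1.
    case: i ci xvy => [p|q] /=.
      case: (boolP (p \in A)) => pA; last by move/eqP; rewrite eq_sym oner_eq0.
      by move=> _ /andP[? ?]; apply: (cover p qm) => //; lra.
    (* With w = (1 - l) pm + l q, the interval of [q] is [w + (1 - l), w + 1[, the end of the range
       allowed by [cover]. *)
    case: (boolP (q \in B)) => qB; last by move/eqP; rewrite eq_sym oner_eq0.
    by move=> _ /andP[? ?]; apply: (cover pm q) => //; lra.
  by rewrite (bigD1 r)//= rC rv mulr1 lerDl sumr_ge0.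
have rhs0 : 0 <= \sum_(j < k) (j \in C)%:R * (j%:R <= v < j%:R + 1)%R%:R :> R.
  by rewrite sumr_ge0// => j _; rewrite mulr_ge0.
have [vc|cv] := ltP v c0.
  rewrite [X in _ + X]big1 ?addr0; last first.
    move=> q _; case: (boolP (q \in B)) => qB; last by rewrite mul0r.
    have /= qq := qmin q qB.
    rewrite (_ : _ <= _ < _ = false) ?mulr0//; apply/negbTE/negP => /andP[xv _].
    have : l * qm%:R <= l * q%:R by rewrite ler_pM2l// ler_nat.
    by rewrite /c0 in vc; lra.
  under eq_bigr do rewrite -natrM mulnb.
  have [/existsP[p /andP[pA pv]]|/existsPn P0] := boolP [exists p : 'I_k, (p \in A)
      && ((1 - l) * p%:R + l * qm%:R <= v <
        (1 - l) * p%:R + l * qm%:R + (1 - l))].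
    apply: le_trans (key (inl p) _ pv); last by rewrite /= pA.
    apply: sum_bool_le1 => i j /andP[_ iv] /andP[_ jv].
    by apply: (lt_unique (1 - l) (l * qm%:R)) => //; lra.
  by rewrite big1// => p _; rewrite (negbTE (P0 _)).
rewrite [X in X + _]big1 ?add0r; last first.
  move=> p _; case: (boolP (p \in A)) => pA; last by rewrite mul0r.
  have /= pp := pmax p pA.
  rewrite (_ : _ <= _ < _ = false) ?mulr0//; apply/negbTE/negP => /andP[_ vx].
  have : (1 - l) * p%:R <= (1 - l) * pm%:R by rewrite ler_pM2l// ler_nat.
  by rewrite /c0 in cv; lra.
under eq_bigr do rewrite -natrM mulnb.
have [/existsP[q /andP[qB qv]]|/existsPn P0] := boolP [exists q : 'I_k, (q \in B)
    && ((1 - l) * (pm%:R + 1) + l * q%:R <= v <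
      (1 - l) * (pm%:R + 1) + l * q%:R + l)].
  apply: le_trans (key (inr q) _ qv); last by rewrite /= qB.
  apply: sum_bool_le1 => i j /andP[_ iv] /andP[_ jv].
  by apply: (lt_unique l ((1 - l) * (pm%:R + 1))) => //; lra.
by rewrite big1// => q _; rewrite (negbTE (P0 _)).
Qed.

(** The relation [S] is left arbitrary so that the property passes to products, and so from one
    coordinate to m. *)
Definition prekopa_leindler (I : finType) (S : I -> I -> I -> Prop) :=
  forall a b h : I -> R,
  (forall i, 0 <= a i) -> (forall i, 0 <= b i) -> (forall i, 0 <= h i) ->
  (forall x y z, S x y z -> a x `^ (1 - l) * b y `^ l <= h z) ->
  (\sum_i a i) `^ (1 - l) * (\sum_i b i) `^ l <= \sum_i h i.

(** Young's inequality with the conjugate exponents 1 / (1 - l) and 1 / l. *)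
Lemma weighted_am_gm (a b : R) : 0 <= a -> 0 <= b ->
  a `^ (1 - l) * b `^ l <= (1 - l) * a + l * b.
Proof.
move=> a0 b0.
have := @conjugate_powR R (a `^ (1 - l)) (b `^ l) (1 - l)^-1 l^-1.
rewrite !powR_ge0 !invr_gt0 !invrK -!powRrM !mulfV ?gt_eqF// !powRr1// subrK.
by rewrite [a * _]mulrC [b * _]mulrC; exact.
Qed.

(** Tensorization: the property of [T] bounds the sums over fibres, and that of [S] applies to these
    sums. *)
Lemma prekopa_leindler_prod (I J : finType) S T :
  @prekopa_leindler I S -> @prekopa_leindler J T ->
  @prekopa_leindler (I * J)%type (fun x y z => S x.1 y.1 z.1 /\ T x.2 y.2 z.2).
Proof.
move=> plS plT a b h a0 b0 h0 abh.
have sumE (u : I * J -> R) : \sum_p u p = \sum_i \sum_j u (i, j).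
  by rewrite pair_big; apply: eq_bigr => -[].
rewrite !sumE; apply: plS; do ?by move=> i; exact: sumr_ge0.
by move=> x y z Sxyz; apply: plT => // x' y' z' T'; exact: abh.
Qed.

(** Dividing [a] and [b] by their maxima makes their level sets nonempty for the same levels v < 1,
    as Brunn-Minkowski requires. Integration over v gives the inequality with an arithmetic mean of
    the normalized sums, and [weighted_am_gm] turns it into the geometric one. *)
Lemma prekopa_leindler_ord k : @prekopa_leindler 'I_k
  (fun x y z => between (x : nat)%:R (y : nat)%:R (z : nat)%:R).
Proof.
move=> a b h a0 b0 h0 abh.
have sum_h : 0 <= \sum_i h i by exact: sumr_ge0.
have zero (u : 'I_k -> R) : (forall i, 0 <= u i) -> (forall i, ~~ (0 < u i)) ->
    \sum_i u i = 0.
  by move=> u0 un; apply: big1 => i _; apply/eqP; rewrite eq_le u0 leNgt un.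
have [/existsP[i0 ai0]|] := boolP [exists i, 0 < a i]; last first.
  by move/existsPn => /(zero _ a0) ->; rewrite powR0 ?gt_eqF// mul0r.
have [/existsP[j0 bj0]|] := boolP [exists i, 0 < b i]; last first.
  by move/existsPn => /(zero _ b0) ->; rewrite (@powR0 _ l) ?gt_eqF// mulr0.
have [p _ pmax] := arg_maxP a (erefl : xpredT i0).
have [q _ qmax] := arg_maxP b (erefl : xpredT j0).
have ap : 0 < a p by exact: lt_le_trans (pmax i0 _).
have bq : 0 < b q by exact: lt_le_trans (qmax j0 _).
set M := a p `^ (1 - l) * b q `^ l.
have M0 : 0 < M by rewrite mulr_gt0// powR_gt0.
pose c (i : 'I_k + 'I_k) : R := match i with inl _ => 1 - l | inr _ => l end.
pose y (i : 'I_k + 'I_k) : R := match i with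
  | inl i => a i / a p | inr j => b j / b q end.
have y0 i : 0 <= y i by case: i => i; rewrite divr_ge0.
have ya1 i : a i / a p <= 1 by rewrite ler_pdivrMr// mul1r; exact: pmax.
have yb1 i : b i / b q <= 1 by rewrite ler_pdivrMr// mul1r; exact: qmax.
have c0 i : 0 <= c i by case: i => i; rewrite ltW.
(* Here the variable of integration is the level, and each value y is the length of [0, y[. *)
have := @le_sum_itv R _ _ c (fun=> 0) y (fun=> 1) (fun=> 0) (fun j => h j / M).
rewrite [X in _ -> _ -> _ -> _ -> _ -> X <= _]big_sumType /=.
under eq_bigr do rewrite subr0.
under [X in _ -> _ -> _ -> _ -> _ -> _ + X <= _]eq_bigr do rewrite subr0.
under [X in _ -> _ -> _ -> _ -> _ -> _ <= X]eq_bigr do rewrite subr0 mul1r.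
rewrite -!mulr_sumr -!mulr_suml => main.
have {main} : (1 - l) * ((\sum_i a i) / a p) + l * ((\sum_i b i) / b q)
    <= (\sum_i h i) / M.
  apply: main => //; first by move=> j; rewrite divr_ge0// ltW.
  move=> v; rewrite big_sumType /= -!mulr_sumr.
  rewrite [leRHS]mul1r.
  have [v0|v0] := leP 0 v; last first.
    rewrite [X in _ * X + _]big1// [X in _ + _ * X]big1// !mulr0 addr0.
    by rewrite sumr_ge0.
  rewrite -!natr_sum.
  have cardE (u : 'I_k -> R) :
      (\sum_i (v < u i)%R)%N = #|finset.finset (fun i => v < u i)|.
    rewrite -sum1_card [RHS]big_mkcond; apply: eq_bigr => i _.
    by rewrite finset.in_set; case: (_ < _).
  rewrite !cardE.
  have [v1|v1] := ltP v 1; last first.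
    rewrite (_ : finset.finset (fun i => v < a i / a p) = finset.set0); last first.
      apply/finset.setP => i; rewrite finset.in_set finset.in_set0.
      apply/negbTE; rewrite -leNgt.
      exact: le_trans (ya1 i) v1.
    rewrite (_ : finset.finset (fun i => v < b i / b q) = finset.set0); last first.
      apply/finset.setP => i; rewrite finset.in_set finset.in_set0.
      apply/negbTE; rewrite -leNgt.
      exact: le_trans (yb1 i) v1.
    by rewrite cards0 !mulr0 addr0.
  apply: discrete_brunn_minkowski.
  - by apply/set0Pn; exists p; rewrite finset.in_set mulfV// gt_eqF.
  - by apply/set0Pn; exists q; rewrite finset.in_set mulfV// gt_eqF.
  move=> i j r; rewrite !finset.in_set !ltr_pdivlMr// => vi vj ijr.
  apply: lt_le_trans (abh _ _ _ ijr); rewrite /M.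
  have -> : v * (a p `^ (1 - l) * b q `^ l) =
      (v * a p) `^ (1 - l) * (v * b q) `^ l.
    rewrite !powRM ?(ltW ap) ?(ltW bq)// mulrACA; congr (_ * _).
    have [->|vn0] := eqVneq v 0; first by rewrite powR0 ?gt_eqF// mul0r.
    by rewrite -powRD ?subrK ?powRr1// vn0 implybT.
  apply: ltr_pM; rewrite ?powR_ge0//; apply: gt0_ltr_powR => //;
    rewrite nnegrE// ?mulr_ge0// ltW//.
rewrite ler_pdivlMr// => main; apply: le_trans main.
have ga : 0 <= (\sum_i a i) / a p by rewrite divr_ge0 ?sumr_ge0// ltW.
have gb : 0 <= (\sum_i b i) / b q by rewrite divr_ge0 ?sumr_ge0// ltW.
have := weighted_am_gm ga gb; rewrite -(ler_pM2r M0); apply: le_trans.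
rewrite /M mulrACA -!powRM// ?(ltW ap) ?(ltW bq)//.
by rewrite !divfK// gt_eqF.
Qed.

Lemma prekopa_leindler_tuple k m : @prekopa_leindler (m.-tuple 'I_k)
  (fun x y z => forall j, between (tnth x j : nat)%:R (tnth y j : nat)%:R
                                  (tnth z j : nat)%:R).
Proof.
elim: m => [|m IH] a b h a0 b0 h0 abh.
  have sumE (u : 0.-tuple 'I_k -> R) : \sum_i u i = u [tuple].
    by rewrite (bigD1 [tuple])//= big1 ?addr0// => i /negP[]; apply/eqP; exact: tuple0.
  by rewrite !sumE; apply: abh => -[].
have sumE (u : m.+1.-tuple 'I_k -> R) :
    \sum_i u i = \sum_(p : 'I_k * m.-tuple 'I_k) u (cons_tuple p.1 p.2).
  rewrite (reindex (fun p : 'I_k * m.-tuple 'I_k => cons_tuple p.1 p.2))//=.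
  exists (fun t => (thead t, [tuple of behead t])) => [[x t] _|t _] /=.
    by rewrite theadE; congr (_, _); apply: val_inj.
  by rewrite [t in RHS]tuple_eta; apply: val_inj.
rewrite !sumE.
apply: (prekopa_leindler_prod (@prekopa_leindler_ord k) IH) => //.
move=> [x s] [y t] [z u] [/= xyz stu]; apply: abh => j.
by case: (unliftP ord0 j) => [i|] -> //; rewrite !tnthS.
Qed.

End discrete_prekopa_leindler.

(** * A moment comparison of Borell type *)

Section moments.
Context {R : realType}.
Local Notation leb := (@lebesgue_measure R).

Lemma integral_exprn n (b : R) : (0 <= b)%R ->
  \int[leb]_(x in `[0%R, b]) (x ^+ n)%:E = (b ^+ n.+1 / n.+1%:R)%:E.
Proof.
rewrite le_eqVlt => /predU1P[<-|b0].
  by rewrite set_itv1 integral_set1 expr0n mul0r.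
have cX k (c : R) : continuous (fun x : R => (x ^+ k * c)%R : R^o).
  by move=> x; apply: cvgMl; exact: exprn_continuous.
rewrite (@continuous_FTC2 _ _ (fun x => x ^+ n.+1 / n.+1%:R)%R)//.
- by rewrite expr0n mul0r sube0.
- by apply: continuous_subspaceT => x; exact: exprn_continuous.
- split.
  + by move=> x _; apply: derivableM => //; exact: exprn_derivable.
  + by apply/cvg_at_right_filter; exact: cX.
  + by apply/cvg_at_left_filter; exact: cX.
- move=> x _; rewrite derive1Mr; last exact: exprn_derivable.
  by rewrite exp_derive1 -mulr_natl mulrAC mulfV// mul1r.
Qed.

Lemma integral_expRNM (a r : R) : (0 < a)%R ->
  \int[leb]_(x in `[r, +oo[) (expR (- a * x))%:E = (expR (- a * r) / a)%:E.
Proof.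
move=> a0.
have cexp : continuous (fun z : R^o => expR (- a * z)).
  move=> z; apply: continuous_comp; last exact: continuous_expR.
  by apply: continuousM => //; apply: (@continuousN _ R^o); exact: cst_continuous.
rewrite (@ge0_continuous_FTC2y _ _
  (fun x => - (expR (- a * x) / a))%R _ 0%R)//.
- by rewrite sub0e EFinN oppeK.
- exact: continuous_subspaceT.
- rewrite -oppr0; apply: cvgN; rewrite -(mul0r a^-1%R); apply: cvgMl.
  rewrite (_ : (fun x => expR (- a * x)) =
               (fun z => expR (- z)) \o (fun z => a * z))%R; last first.
    by apply: eq_fun => x; rewrite mulNr.
  apply: (@cvg_comp _ _ _ _ _ _ (pinfty_nbhs R)); last exact: cvgr_expR.
  exact: gt0_cvgMry.
- by apply: cvgN; apply: cvgMl; apply/cvg_at_right_filter; exact: cexp.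
- move=> z _; rewrite derive1N; last by [].
  rewrite derive1Mr; last by [].
  rewrite derive1_comp// derive1E.
  have /funeqP -> := @derive_expR R.
  by rewrite derive1Ml// derive1_id mulr1 mulrN mulNr opprK mulfK// gt_eqF.
Qed.

Lemma measurable_le_bool d (T : measurableType d) (u v : T -> R) :
  measurable_fun setT u -> measurable_fun setT v ->
  measurable_fun setT (fun x => ((u x <= v x)%R%:R : R)).
Proof.
move=> leb' mv; rewrite (_ : (fun x => _) = \1_[set x | (u x <= v x)%R]).
  apply: measurable_indic; have := measurable_fun_ler leb' mv.
  by move=> /(_ measurableT [set true] I); rewrite setTI.
by apply/funext => x; rewrite indicE mem_setE.
Qed.

(** Tonelli on 0 <= r <= x, where r^n integrates to x^(n+1) / (n+1). This absorbs the factor n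
    r^(n-1) of the theorem. *)
Lemma integral_moment n (g : R -> R) :
  (forall x, 0 <= g x)%R -> measurable_fun setT g ->
  n.+1%:R%:E * \int[leb]_(r in `[0%R, +oo[)
    ((r ^+ n)%:E * \int[leb]_(x in `[r, +oo[) (g x)%:E) =
  \int[leb]_(x in `[0%R, +oo[) (x ^+ n.+1 * g x)%:E.
Proof.
move=> g0 mg.
pose k (p : R * R) := (p.1 ^+ n * (0 <= p.1)%R%:R * (p.1 <= p.2)%R%:R * g p.2)%R%:E.
have k0 p : 0 <= k p.
  rewrite lee_fin; case: (leP 0%R p.1) => p0; last by rewrite /= mulr0n mulr0 !mul0r.
  by rewrite !mulr_ge0// exprn_ge0.
have mk : measurable_fun setT k.
  apply/measurable_EFinP; apply: measurable_funM; last first.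
    exact: measurableT_comp mg measurable_snd.
  apply: measurable_funM; last exact: measurable_le_bool.
  by apply: measurable_funM; [exact: measurable_funX|exact: measurable_le_bool].
transitivity (n.+1%:R%:E * \int[leb]_r \int[leb]_x k (r, x)).
  congr (_ * _); rewrite integral_mkcond; apply: eq_integral => r _.
  rewrite patchE mem_setE in_itv/= andbT; case: ifPn => r0; last first.
    by rewrite integral0_eq// => x _; rewrite /k /= (negbTE r0) mulr0n mulr0 !mul0r.
  rewrite integral_mkcond -ge0_integralZl//; last first.
  - by rewrite lee_fin exprn_ge0.
  - by move=> x _; rewrite patchE; case: ifP; rewrite // lee_fin.
  - apply/(measurable_restrictT (EFin \o g)) => //.
    by apply/measurable_EFinP; exact: measurable_funTS.
  apply: eq_integral => x _; rewrite /k /= r0 mulr1 patchE mem_setE in_itv/= andbT.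
  by case: (r <= x)%R; rewrite /= ?(mulr1n, mulr0n) ?mulr1 ?EFinM ?mulr0 ?mul0r ?mule0 ?mul0e.
rewrite fubini_tonelli// -ge0_integralZl//; last first.
- by move=> x _; exact: integral_ge0.
- exact: measurable_fun_fubini_tonelli_G.
rewrite [RHS]integral_mkcond; apply: eq_integral => x _.
rewrite patchE mem_setE in_itv/= andbT; case: ifPn => x0; last first.
  rewrite integral0_eq ?mule0// => r _; rewrite /k /=.
  case: (leP 0%R r) => r0; last by rewrite /= mulr0n mulr0 !mul0r.
  rewrite (_ : (r <= x)%R = false) ?mulr0n ?mulr0 ?mul0r//; apply/negbTE.
  by apply: contra x0; exact: le_trans.
transitivity (n.+1%:R%:E * \int[leb]_(r in `[0%R, x]) ((g x)%:E * (r ^+ n)%:E)).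
  congr (_ * _); rewrite [RHS]integral_mkcond; apply: eq_integral => r _.
  rewrite patchE mem_setE in_itv/= /k /=.
  by case: (0 <= r)%R; case: (r <= x)%R; rewrite /= ?(mulr0n, mulr1n, mulr0, mul0r, mulr1)//
    -EFinM mulrC.
rewrite ge0_integralZl//; last 3 first.
- apply/measurable_EFinP; apply: measurable_funTS; exact: measurable_funX.
- by move=> r; rewrite /= in_itv/= => /andP[r0 _]; rewrite lee_fin exprn_ge0.
- by rewrite lee_fin.
rewrite integral_exprn// -!EFinM; congr (_%:E).
by rewrite mulrCA [(n.+1%:R * _)%R]mulrC divfK// mulrC.
Qed.

(** Induction through [integral_moment]: the tail integral of the exponential is the exponential
    divided by [a], so each step contributes (n + 1) / a. *)
Lemma moment_expR n (a : R) : (0 < a)%R ->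
  \int[leb]_(x in `[0%R, +oo[) (x ^+ n * expR (- a * x))%:E =
  (n`!%:R / a ^+ n.+1)%:E.
Proof.
move=> a0.
have mexp : measurable_fun setT (fun x : R => expR (- a * x)).
  by apply: measurableT_comp => //; exact: measurable_funM.
elim: n => [|n IH].
  under eq_integral do rewrite mul1r.
  by rewrite integral_expRNM// mulr0 expR0.
rewrite -integral_moment//.
under eq_integral do rewrite integral_expRNM// -EFinM mulrA EFinM muleC.
rewrite ge0_integralZl//; last 3 first.
- apply/measurable_EFinP; apply: measurable_funTS; apply: measurable_funM => //.
- move=> x; rewrite /= in_itv/= andbT => x0.
  by rewrite lee_fin mulr_ge0 ?expR_ge0// exprn_ge0.
- by rewrite lee_fin invr_ge0 ltW.
rewrite IH -!EFinM; congr (_%:E); rewrite factS natrM [in RHS]exprS invfM.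
by ring.
Qed.

End moments.

Section moment_comparison.
Context {R : realType}.
Local Notation leb := (@lebesgue_measure R).
Variables F D : R -> R.
Hypothesis F0 : forall x, (0 <= F x)%R.
Hypothesis mF : measurable_fun setT F.
Hypothesis mD : measurable_fun setT D.
Hypothesis FD : forall x, (0 <= x)%R -> (F x <= D x)%R.
Hypothesis B0 : (0 < F 0)%R.
Hypothesis FD_concave : forall l x, (0 < l < 1)%R -> (0 <= x)%R ->
  (F 0 `^ (1 - l) * F x `^ l <= D (l * x))%R.

(* Let E be the exponential with value F 0 at 0 and integral C, and s0 the last
   point where F exceeds E: after s0, F <= E, and before s0, concavity between 0
   and such points gives E <= D. *)
Lemma moment_comparison_lt n (C : R) :
  \int[leb]_(x in `[0%R, +oo[) (D x)%:E < C%:E ->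
  \int[leb]_(x in `[0%R, +oo[) (x ^+ n.+1 * F x)%:E <=
    (n.+1`!%:R * C ^+ n.+2 / F 0 ^+ n.+1)%:E.
Proof.
move=> DC.
have D0 x : (0 <= x)%R -> (0 <= D x)%R.
  by move=> x0; exact: le_trans (F0 x) (FD x0).
have mD' : measurable_fun (`[0%R, +oo[%classic : set R) (EFin \o D).
  by apply/measurable_EFinP; exact: measurable_funTS.
have C0 : (0 < C)%R.
  rewrite -lte_fin; apply: le_lt_trans DC; apply: integral_ge0 => x /=.
  by rewrite in_itv/= andbT => x0; rewrite lee_fin D0.
pose B := F 0; have Bgt0 : (0 < B)%R by [].
rewrite -/B.
(* The rate for which the exponential [E] has integral [C]. *)
pose a := (B / C)%R.
have a0 : (0 < a)%R by rewrite divr_gt0.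
pose E x := (B * expR (- a * x))%R.
have E0 x : (0 <= E x)%R by rewrite mulr_ge0 ?expR_ge0// ltW.
have mexp : measurable_fun setT (fun x : R => expR (- a * x)).
  by apply: measurableT_comp => //; exact: measurable_funM.
have mE : measurable_fun setT E by exact: measurable_funM.
have intE k : \int[leb]_(x in `[0%R, +oo[) (x ^+ k * E x)%:E =
    (B * (k`!%:R / a ^+ k.+1))%:E.
  under eq_integral do rewrite /E mulrCA EFinM.
  rewrite ge0_integralZl//; last 3 first.
  - apply/measurable_EFinP; apply: measurable_funTS; apply: measurable_funM => //.
  - move=> x; rewrite /= in_itv/= andbT => x0.
    by rewrite lee_fin mulr_ge0 ?expR_ge0// exprn_ge0.
  - by rewrite lee_fin ltW.
  by rewrite moment_expR.
have intE0 : \int[leb]_(x in `[0%R, +oo[) (E x)%:E = C%:E.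
  have := intE 0%N; under eq_integral do rewrite mul1r.
  move=> ->; congr (_%:E); rewrite fact0 expr1 /a.
  by rewrite mul1r invf_div mulrCA mulfV ?mulr1// gt_eqF.
pose S := [set s : R | (0 <= s)%R /\ (E s < F s)%R].
have SD s s1 : S s1 -> (0 <= s)%R -> (s < s1)%R -> (E s <= D s)%R.
  move=> [s10 FEs1]; rewrite le_eqVlt => /predU1P[<- _|s0 ss1].
    by rewrite /E mulr0 expR0 mulr1 FD.
  have s1p : (0 < s1)%R by exact: lt_trans ss1.
  have l01 : (0 < s / s1 < 1)%R by rewrite divr_gt0// ltr_pdivrMr// mul1r.
  have /andP[l0 l1] := l01.
  have := FD_concave l01 s10; rewrite divfK ?gt_eqF//; apply: le_trans.
  have -> : E s = (B `^ (1 - s / s1) * E s1 `^ (s / s1))%R.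
    rewrite /E powRM ?expR_ge0 ?(ltW Bgt0)// -expRM mulrA -powRD; last first.
      by rewrite (gt_eqF Bgt0) implybT.
    rewrite subrK powRr1 ?(ltW Bgt0)//; congr (_ * expR _)%R.
    by rewrite -mulrA; congr (_ * _)%R; rewrite mulrC divfK// gt_eqF.
  apply: ler_wpM2l; first exact: powR_ge0.
  apply: ge0_ler_powR; rewrite ?nnegrE ?E0 ?F0//; exact: ltW.
(* Otherwise E <= D on the whole half-line, and [C] would be at most the integral of [D]; the strict
   inequality excludes this. *)
have ubS : has_ubound S.
  apply: contrapT => nub; move: DC; rewrite -intE0 ltNge => /negP; apply.
  apply: ge0_le_integral => //.
  - by move=> x _; rewrite lee_fin.
  - by apply/measurable_EFinP; exact: measurable_funTS.
  move=> s; rewrite /= in_itv/= andbT => s0; rewrite lee_fin.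
  apply: contrapT => DE; apply: nub; exists s => s1 Ss1.
  by rewrite leNgt; apply/negP => ss1; apply: DE; exact: (SD _ _ Ss1).
(* If [S] is empty, [sup] returns 0, and the case s0 <= s below covers the half-line. *)
set s0 := sup S.
have s0_ge0 : (0 <= s0)%R.
  have [[s Ss]|S0] := pselect (exists s, S s).
    by apply: le_trans (sup_upper_bound _ Ss); [case: Ss|split => //; exists s].
  by rewrite /s0 (_ : S = set0) ?sup0// -subset0 => s Ss; apply: S0; exists s.
(* After integration the [s0] term is s0^(n+1) C on the left and at most that on the right. The
   additive form avoids subtracting the moment of [F], not yet known to be finite. *)
have pointwise s : (0 <= s)%R ->
    (s ^+ n.+1 * F s + s0 ^+ n.+1 * E s <= s ^+ n.+1 * E s + s0 ^+ n.+1 * D s)%R.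
  move=> s_ge0; have FDs := FD s_ge0.
  have p0 : (0 <= s ^+ n.+1)%R by rewrite exprn_ge0.
  have q0 : (0 <= s0 ^+ n.+1)%R by rewrite exprn_ge0.
  have [ss0|s0s] := ltP s s0.
    have [|s1 Ss1 ss1] := sup_gt _ ss0.
      apply/set0P/negP => /eqP S0; move: ss0.
      by rewrite /s0 S0 sup0 ltNge s_ge0.
    have EDs := SD _ _ Ss1 s_ge0 ss1.
    have pq : (s ^+ n.+1 <= s0 ^+ n.+1)%R.
      by rewrite lerXn2r ?nnegrE// ltW.
    nra.
  have qp : (s0 ^+ n.+1 <= s ^+ n.+1)%R by rewrite lerXn2r ?nnegrE.
  have [FEs|EFs] := leP (F s) (E s); first by nra.
  (* The supremum may belong to [S]; at that point F <= D concludes. *)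
  have /eqP <- : s == s0.
    have Ss : S s by [].
    rewrite eq_le s0s andbT; apply: (sup_upper_bound _ Ss).
    by split => //; exists s.
  nra.
have mX k (g : R -> R) : measurable_fun setT g ->
    measurable_fun (`[0%R, +oo[%classic : set R) (fun x => (x ^+ k * g x)%:E).
  move=> mg; apply/measurable_EFinP; apply: measurable_funTS.
  by apply: measurable_funM.
have mc (c : R) (g : R -> R) : measurable_fun setT g ->
    measurable_fun (`[0%R, +oo[%classic : set R) (fun x => c%:E * (g x)%:E).
  move=> mg; apply: measurable_funeM.
  by apply/measurable_EFinP; exact: measurable_funTS.
have c0 (c : R) (g : R -> R) : (0 <= c)%R -> (forall x, (0 <= x)%R -> (0 <= g x)%R) ->
    forall x, (`[0%R, +oo[%classic : set R) x -> 0 <= c%:E * (g x)%:E.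
  move=> c0 g0 x /=; rewrite in_itv/= andbT => x0.
  by rewrite mule_ge0// lee_fin// g0.
have x0 k (g : R -> R) : (forall x, (0 <= x)%R -> (0 <= g x)%R) ->
    forall x, (`[0%R, +oo[%classic : set R) x -> 0 <= (x ^+ k * g x)%:E.
  move=> g0 x /=; rewrite in_itv/= andbT => x0.
  by rewrite lee_fin mulr_ge0 ?exprn_ge0// g0.
have q0 : (0 <= s0 ^+ n.+1)%R by rewrite exprn_ge0.
have : \int[leb]_(x in `[0%R, +oo[) ((x ^+ n.+1 * F x)%:E + (s0 ^+ n.+1)%:E * (E x)%:E)
    <= \int[leb]_(x in `[0%R, +oo[) ((x ^+ n.+1 * E x)%:E + (s0 ^+ n.+1)%:E * (D x)%:E).
  apply: ge0_le_integral => //.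
  - by move=> x ?; apply: adde_ge0; [exact: x0|exact: c0].
  - by apply: emeasurable_funD; [exact: mX|exact: mc].
  - by apply: emeasurable_funD; [exact: mX|exact: mc].
  - move=> x; rewrite /= in_itv/= andbT => /pointwise.
    by rewrite -!EFinM -!EFinD lee_fin.
rewrite !ge0_integralD//; [|exact: x0|exact: mX|exact: c0|exact: mc|
  exact: x0|exact: mX|exact: c0|exact: mc].
have intZ (c : R) (g : R -> R) : (0 <= c)%R -> measurable_fun setT g ->
    (forall x, (0 <= x)%R -> (0 <= g x)%R) ->
    \int[leb]_(x in `[0%R, +oo[) (c%:E * (g x)%:E) =
    c%:E * \int[leb]_(x in `[0%R, +oo[) (g x)%:E.
  move=> c0' mg g0; apply: ge0_integralZl => //.
    by apply/measurable_EFinP; exact: measurable_funTS.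
  by move=> x; rewrite /= in_itv/= andbT => /g0; rewrite lee_fin.
rewrite (intZ _ E)// (intZ _ D)//.
rewrite intE intE0 => main.
have -> : (n.+1`!%:R * C ^+ n.+2 / B ^+ n.+1 = B * (n.+1`!%:R / a ^+ n.+2))%R.
  rewrite /a expr_div_n invf_div (exprS B n.+1).
  by field; rewrite !gt_eqF// exprn_gt0.
have fD : \int[leb]_(x in `[0%R, +oo[) (D x)%:E \is a fin_num.
  rewrite ge0_fin_numE; first exact: lt_trans DC (ltry _).
  by apply: integral_ge0 => x; rewrite /= in_itv/= andbT => /D0; rewrite lee_fin.
rewrite -(@leeD2rE _ ((s0 ^+ n.+1)%:E * C%:E)) //; apply: le_trans main _.
by rewrite leeD2l// lee_wpmul2l ?lee_fin// ltW.
Qed.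

(** Let [C] decrease to the integral of [D]. If that integral is infinite, so is the right-hand
    side; if it is finite, the bound for one larger [C] makes the moment of [F] finite. *)
Lemma moment_comparison n :
  (\int[leb]_(x in `[0%R, +oo[) (x ^+ n.+1 * F x)%:E) * (F 0)%:E ^+ n.+1 <=
  n.+1`!%:R%:E * (\int[leb]_(x in `[0%R, +oo[) (D x)%:E) ^+ n.+2.
Proof.
have D0 : 0 <= \int[leb]_(x in `[0%R, +oo[) (D x)%:E.
  apply: integral_ge0 => x; rewrite /= in_itv/= andbT => x0.
  by rewrite lee_fin (le_trans (F0 x))// FD.
have X0 : 0 <= \int[leb]_(x in `[0%R, +oo[) (x ^+ n.+1 * F x)%:E.
  apply: integral_ge0 => x; rewrite /= in_itv/= andbT => x0.
  by rewrite lee_fin mulr_ge0// exprn_ge0.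
have := @moment_comparison_lt n.
case: (\int[leb]_(x in `[0%R, +oo[) (D x)%:E) D0 => [A|_ _|//]; last first.
  have yX k : (+oo : \bar R) ^+ k.+1 = +oo.
    by elim: k => // k IH; rewrite expeS IH mulyy.
  by rewrite yX gt0_muley ?leey// lte_fin ltr0n fact_gt0.
rewrite lee_fin => A0 lt_bound.
case: (\int[leb]_(x in `[0%R, +oo[) (x ^+ n.+1 * F x)%:E) X0 lt_bound =>
    [X||//]; last first.
  by move=> _ /(_ (A + 1)%R); rewrite lte_fin ltrDl ltr01 leye_eq => /(_ isT).
rewrite lee_fin => X0 lt_bound.
rewrite -!EFin_expe -!EFinM lee_fin.
have cC : (fun C : R => n.+1`!%:R * C ^+ n.+2)%R @ A^'+ --> (n.+1`!%:R * A ^+ n.+2)%R.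
  by apply: cvgMr; apply: cvg_at_right_filter; exact: exprn_continuous.
apply: (cvgr_to_ge cC); near=> C.
rewrite -ler_pdivlMr ?exprn_gt0// -lee_fin; apply: lt_bound.
by rewrite lte_fin; near: C; exact: nbhs_right_gt.
Unshelve. all: by end_near.
Qed.

End moment_comparison.

(** * Overlaps of unimodal functions *)

(* Unlike ge0_le_integral, this needs no measurability, as the integral of a
   nonnegative function is the supremum of those of the simple functions below. *)
Lemma le_lower_integral d (T : measurableType d) (R : realType)
    (nu : {measure set T -> \bar R}) (D : set T) (f g : T -> \bar R) :
  (forall x, D x -> 0 <= f x) -> (forall x, D x -> f x <= g x) ->
  \int[nu]_(x in D) f x <= \int[nu]_(x in D) g x.
Proof.
move=> f0 fg; have g0 x : D x -> 0 <= g x.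
  by move=> Dx; exact: le_trans (f0 x Dx) (fg x Dx).
rewrite !ge0_integralE//; apply: le_ereal_sup => _ [h hf <-].
exists h => // x; apply: le_trans (hf x) _; rewrite !patchE.
by case: ifPn => // /set_mem /fg.
Qed.

Section unimodal.
Context {R : realType}.
Local Notation leb := (@lebesgue_measure R).

Definition unimodal (phi : R -> R) :=
  forall x y z, (x <= y)%R -> (y <= z)%R -> (Num.min (phi x) (phi z) <= phi y)%R.

(** The superlevel sets are intervals. Fibres of [f] are thus Borel even where [f] is only Lebesgue
    measurable. *)
Lemma unimodal_measurable phi : unimodal phi -> measurable_fun setT phi.
Proof.
move=> uphi.
apply: (measurability (@RGenOInfty.G R)) => [|/= _ [_] [r] -> <-].
  exact: RGenOInfty.measurableE.
rewrite setTI; apply: is_interval_measurable => x z /=.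
rewrite !in_itv/= !andbT => rx rz y /andP[xy yz].
by rewrite in_itv/= andbT (lt_le_trans _ (uphi x y z xy yz))// lt_min rx.
Qed.

Lemma layer_cake (phi : R -> R) :
  (forall x, 0 <= phi x)%R -> measurable_fun setT phi ->
  \int[leb]_x (phi x)%:E =
  \int[leb]_(s in `[0%R, +oo[) leb [set x | (s < phi x)%R].
Proof.
move=> phi0 mphi.
pose k (p : R * R) := ((0 <= p.2)%R%:R * (1 - (phi p.1 <= p.2)%R%:R))%R%:E : \bar R.
have ltE x s : (1 - (phi x <= s)%R%:R = (s < phi x)%R%:R :> R)%R.
  by rewrite ltNge; case: (phi x <= s)%R; rewrite ?subrr ?subr0.
have k0 p : 0 <= k p by rewrite lee_fin ltE mulr_ge0.
have mk : measurable_fun setT k.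
  apply/measurable_EFinP; apply: measurable_funM; first exact: measurable_le_bool.
  apply: measurable_funB => //; apply: measurable_le_bool => //.
  exact: measurableT_comp.
have mlt s : measurable [set x | (s < phi x)%R].
  rewrite (_ : mkset _ = phi @^-1` `]s, +oo[%classic); last first.
    by apply/seteqP; split => x /=; rewrite in_itv/= andbT.
  by rewrite -[X in measurable X]setTI; exact: mphi.
transitivity (\int[leb]_x \int[leb]_s k (x, s)).
  apply: eq_integral => x _.
  rewrite (_ : (fun s => k (x, s)) = EFin \o \1_(`[0%R, phi x[%classic : set R)).
    rewrite integral_indic// setIT/= lebesgue_measure_itv/= lte_fin.
    case: ltP => [_|]; first by rewrite sube0.
    by move=> x0; apply/eqP; rewrite eqe eq_le x0 phi0.
  apply/funext => s /=; rewrite /k /= ltE indicE mem_setE in_itv/=.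
  by case: (0 <= s)%R; rewrite /= ?(mulr1n, mulr0n, mul0r, mul1r).
rewrite fubini_tonelli// [RHS]integral_mkcond; apply: eq_integral => s _.
rewrite patchE mem_setE in_itv/= andbT /k /=; case: ifPn => s0; last first.
  by rewrite integral0_eq// => x _; rewrite mulr0n mul0r.
transitivity (\int[leb]_x (\1_[set x | (s < phi x)%R] x)%:E); last first.
  rewrite integral_indic; [congr (lebesgue_measure _); exact: setIT|by []|exact: mlt].
apply: eq_integral => x _.
by rewrite ltE mul1r indicE mem_setE.
Qed.

(** The measure of [I] is at most its diameter, and [G] contains intervals starting at [r] of
    lengths arbitrarily close to that diameter, or arbitrarily long if [I] is unbounded. *)
Lemma length_le_lebesgue (I G : set R) (r : R) : measurable G ->
  (forall x y rho, I x -> I y -> (r <= rho <= r + (y - x))%R -> G rho) ->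
  measurable I -> leb I <= leb G.
Proof.
move=> mG IG mI.
have [->|/set0P[a Ia]] := eqVneq I set0; first by rewrite measure0.
have sub x y : I x -> I y -> (x <= y)%R -> (y - x)%:E <= leb G.
  move=> Ix Iy xy; have <- : leb `[r, (r + (y - x))%R]%classic = (y - x)%:E.
    rewrite lebesgue_measure_itv/= lte_fin ltrDl subr_gt0.
    case: ltP => [_|yx]; first by rewrite -EFinB addrAC subrr add0r.
    by have /eqP -> : x == y by [rewrite eq_le xy yx]; rewrite subrr.
  apply: le_measure; rewrite ?inE// => rho /=; rewrite in_itv/= => /IG; exact.
have [[ubI lbI]|nb] := pselect (has_ubound I /\ has_lbound I); last first.
  suff -> : leb G = +oo by rewrite leey.
  apply/eqyP => A A0; suff [x [y [Ix Iy xyA]]] :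
      exists x y, [/\ I x, I y & (A <= y - x)%R].
    by apply: le_trans (sub x y Ix Iy _); rewrite ?lee_fin//; lra.
  have [ubI|nubI] := pselect (has_ubound I).
    have nlbI : ~ has_lbound I by move=> lbI; exact: nb.
    apply: contrapT => H; apply: nlbI; exists (a - A)%R => x Ix.
    rewrite leNgt; apply/negP => xa; apply: H; exists x, a; split => //.
    by lra.
  apply: contrapT => H; apply: nubI; exists (a + A)%R => x Ix.
  rewrite leNgt; apply/negP => xa; apply: H; exists a, x; split => //.
  by lra.
have supI : has_sup I by split => //; exists a.
have infI : has_inf I by split => //; exists a.
have le_inf_sup : (inf I <= sup I)%R.
  by apply: (@le_trans _ _ a); [exact: inf_lbound|exact: sup_upper_bound].
apply: (@le_trans _ _ (sup I - inf I)%:E).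
  have <- : leb `[inf I, sup I]%classic = (sup I - inf I)%:E.
    rewrite lebesgue_measure_itv/= lte_fin -EFinB.
    case: ltP => // si; have /eqP -> : inf I == sup I by rewrite eq_le le_inf_sup.
    by rewrite subrr.
  apply: le_measure; rewrite ?inE// => x Ix /=; rewrite in_itv/=.
  by rewrite inf_lbound// sup_upper_bound.
apply/lee_addgt0Pr => e e0.
have [|x Ix xe] := @inf_adherent _ I (e / 2) _ infI; first by rewrite divr_gt0.
have [|y Iy ye] := @sup_adherent _ I (e / 2) _ supI; first by rewrite divr_gt0.
have [xy|yx] := leP x y.
  apply: (@le_trans _ _ ((y - x)%:E + e%:E)); last by rewrite leeD2r// sub.
  by rewrite -EFinD lee_fin; lra.
apply: (@le_trans _ _ ((a - a)%:E + e%:E)); last by rewrite leeD2r// sub.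
by rewrite -EFinD lee_fin; lra.
Qed.

(** Compare levels. If phi exceeds s at x, x - r, y and y - r, and r <= rho <= r + (y - x), then y -
    rho lies between x - r and y - r. So phi exceeds s at both y - rho and y, whence G(rho) > s, and
    [length_le_lebesgue] applies. *)
Lemma integral_overlap_le (phi G : R -> R) (r : R) :
  (forall x, 0 <= phi x)%R -> unimodal phi ->
  measurable_fun setT G ->
  (forall rho t, Num.min (phi (t + rho)) (phi t) <= G rho)%R ->
  \int[leb]_t (Num.min (phi t) (phi (t - r)))%:E <=
  \int[leb]_(rho in `[r, +oo[) (G rho)%:E.
Proof.
move=> phi0 uphi mG phiG.
have G0 rho : (0 <= G rho)%R.
  by apply: le_trans (phiG rho 0%R); rewrite le_min !phi0.
have mphi := unimodal_measurable uphi.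
have mphir : measurable_fun setT (fun t : R => phi (t - r)%R).
  by apply: measurableT_comp => //; exact: measurable_funB.
pose Gr rho := (G rho * (r <= rho)%R%:R)%R.
have mGr : measurable_fun setT Gr.
  by apply: measurable_funM => //; exact: measurable_le_bool.
have -> : \int[leb]_(rho in `[r, +oo[) (G rho)%:E = \int[leb]_rho (Gr rho)%:E.
  rewrite integral_mkcond; apply: eq_integral => x _.
  rewrite patchE mem_setE in_itv/= andbT /Gr.
  by case: (r <= x)%R; rewrite ?(mulr1n, mulr0n, mulr1, mulr0).
have mq : measurable_fun setT (fun t : R => Num.min (phi t) (phi (t - r)%R)).
  exact: measurable_minr.
rewrite !layer_cake//; last 2 first.
- by move=> x; rewrite mulr_ge0.
- by move=> x; rewrite le_min !phi0.
have mlt (u : R -> R) s : measurable_fun setT u -> measurable [set x | (s < u x)%R].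
  move=> leb'; rewrite (_ : mkset _ = u @^-1` `]s, +oo[%classic); last first.
    by apply/seteqP; split => x /=; rewrite in_itv/= andbT.
  by rewrite -[X in measurable X]setTI; exact: leb'.
apply: le_lower_integral => // s /=; rewrite in_itv/= andbT => s0.
apply: (@length_le_lebesgue _ _ r); [exact: mlt| |exact: mlt].
move=> x y rho /=; rewrite !lt_min => /andP[phix phixr] /andP[phiy phiyr].
move=> /andP[r_rho rho_xy].
rewrite /Gr r_rho mulr1; apply: lt_le_trans (phiG rho (y - rho)%R).
rewrite subrK lt_min phiy /=; apply: lt_le_trans (uphi (x - r)%R _ (y - r)%R _ _).
- by rewrite lt_min phixr.
- by lra.
- by lra.
Qed.

End unimodal.

(** * Integrals over lattice points and lattice lines *)

Section lattice_points.
Context {R : realType}.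

(** Indexing the box {-N..N}^m by tuples of naturals suits [prekopa_leindler_tuple]; the shift by
    [N] cancels in convex combinations. *)
Definition box_point m N (x : m.-tuple 'I_N.*2.+1) : 'rV[R]_m :=
  (\row_j ((tnth x j)%:R - N%:R))%R.

Lemma box_point_inj m N : injective (@box_point m N).
Proof.
move=> x y /rowP xy; apply: eq_from_tnth => j; apply: val_inj.
by have := xy j; rewrite !mxE => /addIr /eqP; rewrite eqr_nat => /eqP.
Qed.

Lemma integer_lattice_box_point m N (x : m.-tuple 'I_N.*2.+1) :
  @integer_lattice R m (box_point x).
Proof. by move=> j; rewrite mxE rpredB ?rpred_nat. Qed.

Lemma box_pointP m N (y : 'rV[R]_m) : @integer_lattice R m y ->
  (forall j, `|y ord0 j| <= N%:R)%R -> exists x, @box_point m N x = y.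
Proof.
move=> Ly yN.
have yNP j : exists k : 'I_N.*2.+1, (k%:R - N%:R = y ord0 j)%R.
  have /intrP[z yz] := Ly j; have := yN j; rewrite yz -intr_norm (pmulrn _ N) ler_int.
  move=> zN; have z0 : (0 <= z + N%:Z)%R by lia.
  have kN : (absz (z + N%:Z)%R < N.*2.+1)%N by lia.
  exists (Ordinal kN) => /=; apply/eqP; rewrite subr_eq.
  by rewrite pmulrn gez0_abs// intrD.
exists [tuple sval (cid (yNP j)) | j < m]; apply/rowP => j.
by rewrite mxE tnth_mktuple; case: cid.
Qed.

Lemma measurable_rV_set1 m (y : 'rV[R]_m) : measurable [set y].
Proof.
have -> : [set y] = \bigcap_(j in [set: 'I_m]) (coordinate j @^-1` [set y ord0 j]).
  apply/seteqP; split => [_ -> //|z /= yz]; apply/rowP => j; exact: yz.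
apply: fin_bigcap_measurable => // j _.
by rewrite -[X in measurable X]setTI; exact: measurable_coordinate.
Qed.

Lemma lattice_count_setC m : lattice_count R m (~` @integer_lattice R m) = 0.
Proof. by rewrite /lattice_count /= /mrestr setICl measure0. Qed.

Lemma lattice_count_box_point m N (x : m.-tuple 'I_N.*2.+1) :
  lattice_count R m [set box_point x] = 1.
Proof.
rewrite /lattice_count /= /mrestr.
rewrite setIidl; last by move=> _ ->; exact: integer_lattice_box_point.
by rewrite /counting asboolT ?fset_set1 ?finmap.cardfs1.
Qed.

Lemma lattice_count_sigma_finite m : sigma_finite setT (lattice_count R m).
Proof.
(* The complement of the lattice is null, so it can be added to every box. *)
exists (fun N => ~` @integer_lattice R m `|` range (@box_point m N)).
  apply/esym; rewrite -subTset => y _.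
  have [Ly|nLy] := pselect (@integer_lattice R m y); last by exists 0%N => //; left.
  pose s := (\sum_j `|y ord0 j|)%R.
  have s0 : (0 <= s)%R by rewrite sumr_ge0.
  exists (Num.Def.archi_bound s) => //; right.
  have [|x <-] := @box_pointP m (Num.Def.archi_bound s) y Ly; last by exists x.
  move=> j; apply: (@le_trans _ _ s); last exact/ltW/archi_boundP.
  by rewrite /s (bigD1 j)//= lerDl sumr_ge0.
move=> N; split.
  apply: measurableU; first by apply: measurableC; exact: measurable_integer_lattice.
  apply: countable_measurable; first exact: (@measurable_rV_set1 m).
  exact/finite_set_countable/finite_image.
rewrite /lattice_count /= /mrestr.
have fin : finite_set (range (@box_point m N) `&` @integer_lattice R m).
  by apply: finite_setIl; exact: finite_image.
by rewrite setIUl setICl set0U /counting asboolT// ltry.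
Qed.

(* The underlying function of lattice_count, so that the sigma-finite structure
   is found by unification. *)
Definition lattice_counter m : set 'rV[R]_m -> \bar R := lattice_count R m.

HB.instance Definition _ m :=
  Measure.copy (@lattice_counter m) (lattice_count R m).

HB.instance Definition _ m := @Measure_isSigmaFinite.Build _ _ _
  (@lattice_counter m) (@lattice_count_sigma_finite m).

End lattice_points.

Section lattice_integrals.
Import HBNNSimple.
Context {R : realType}.

Lemma lower_integral_setC0 d (T : measurableType d) (nu : {measure set T -> \bar R})
    (L : set T) (f : T -> \bar R) :
  measurable L -> nu (~` L) = 0 -> (forall x, 0 <= f x) ->
  \int[nu]_x f x = \int[nu]_(x in L) f x.
Proof.
move=> mL nuL f0; apply/eqP; rewrite eq_le; apply/andP; split; last first.
  rewrite integral_mkcond; apply: le_lower_integral => x _; rewrite patchE.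
    by case: ifP.
  by case: ifP.
rewrite [leLHS]ge0_integralE// patch_setT; apply: ge_ereal_sup => _ [h hf <-].
rewrite -integralT_nnsfun (@ge0_negligible_integral _ _ _ nu setT (~` L))//.
- rewrite setTD setCK; apply: le_lower_integral => x _; last exact: hf.
  by rewrite lee_fin; exact: fun_ge0.
- exact: measurableC.
- by apply/measurable_EFinP.
- by move=> x _; rewrite lee_fin; exact: fun_ge0.
Qed.

(** For arbitrary nonnegative [phi]: on the lattice, which carries the measure, [phi] is the
    increasing limit of the measurable functions [psi N], finite combinations of indicators of
    points. *)
Lemma integral_lattice_count_cvg m (phi : 'rV[R]_m -> \bar R) :
  (forall y, 0 <= phi y) ->
  [/\ (\sum_x phi (@box_point R m N x)) @[N --> \oo] -->
      \int[lattice_count R m]_y phi y &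
      {homo (fun N => \sum_x phi (@box_point R m N x)) :
        n k / (n <= k)%N >-> n <= k}].
Proof.
move=> phi0; pose L := @integer_lattice R m.
have mL : measurable L by exact: measurable_integer_lattice.
pose psi N (y : 'rV[R]_m) := \sum_(x : m.-tuple 'I_N.*2.+1) phi (box_point x) *
  (\1_[set box_point x] y)%:E :> \bar R.
have ind0 (A : set 'rV[R]_m) y : 0 <= (\1_A y)%:E :> \bar R by rewrite lee_fin.
have psi0 N y : 0 <= psi N y.
  by apply: sume_ge0 => x _; rewrite mule_ge0.
have mindic N (x : m.-tuple 'I_N.*2.+1) : measurable_fun setT
    (fun y => phi (box_point x) * (\1_[set box_point x] y)%:E).
  apply: measurable_funeM; apply/measurable_EFinP.
  by apply: measurable_indic; exact: measurable_rV_set1.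
have mpsi N : measurable_fun setT (psi N).
  by apply: emeasurable_sum => x; exact: mindic.
have intpsi N : \int[lattice_count R m]_y psi N y = \sum_x phi (@box_point R m N x).
  rewrite ge0_integral_sum; [|by []|exact: mindic|by move=> x y _; rewrite mule_ge0].
  apply: eq_bigr => x _; rewrite ge0_integralZl//; last first.
    apply/measurable_EFinP.
    by apply: measurable_indic; exact: measurable_rV_set1.
  rewrite integral_indic//; last exact: measurable_rV_set1.
  by rewrite setIT lattice_count_box_point mule1.
have psi_box N (x : m.-tuple 'I_N.*2.+1) : psi N (box_point x) = phi (box_point x).
  rewrite /psi (bigD1 x)//= indicE mem_set// mule1 big1 ?adde0// => z zx.
  rewrite indicE memNset ?mule0// => /box_point_inj xz.
  by rewrite xz eqxx in zx.
have psi_out N y : ~ range (@box_point R m N) y -> psi N y = 0.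
  move=> Ny; rewrite /psi big1// => x _; rewrite indicE memNset ?mule0//.
  by move=> /= yx; apply: Ny; exists x.
have range_mono n k (y : 'rV[R]_m) : (n <= k)%N -> range (@box_point R m n) y ->
    range (@box_point R m k) y.
  move=> nk [x _ <-].
  have [|z <-] := @box_pointP R m k _ (integer_lattice_box_point x); last by exists z.
  move=> j; rewrite mxE ler_norml; apply/andP; split.
    by rewrite lerBrDr (le_trans (_ : _ <= 0%:R)%R) ?ler_nat ?ler0n// addrC subr_le0 ler_nat.
  have : (tnth x j < n.*2.+1)%N by [].
  rewrite lerBlDr -natrD ler_nat; lia.
have psi_mono y : {homo psi^~ y : n k / (n <= k)%N >-> n <= k}.
  move=> n k nk /=; have [xn|nxn] := pselect (range (@box_point R m n) y).
    have [x _ xy] := range_mono n k y nk xn; case: xn => x' _ x'y.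
    by rewrite -{1}x'y psi_box x'y -xy psi_box.
  by rewrite psi_out.
split; last first.
  move=> n k nk; rewrite -!intpsi; apply: le_lower_integral => // y _.
  exact: psi_mono.
have intL N : \int[lattice_count R m]_y psi N y = \int[lattice_count R m]_(y in L) psi N y.
  by apply: lower_integral_setC0 => //; exact: lattice_count_setC.
rewrite (_ : (fun N => _) = (fun N => \int[lattice_count R m]_(y in L) psi N y));
  last by apply/funext => N; rewrite -intpsi intL.
rewrite (lower_integral_setC0 mL (lattice_count_setC m) phi0).
rewrite [X in _ --> X](_ : _ =
    \int[lattice_count R m]_(y in L) limn (psi^~ y)); last first.
  (* The sequence is constant once the box contains [y]; the sum of the absolute values of the
     coordinates bounds each of them. *)
  apply: eq_integral => y; rewrite inE => Ly; apply/esym/lim_near_cst => //.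
  pose s := (\sum_j `|y ord0 j|)%R.
  have s0 : (0 <= s)%R by rewrite sumr_ge0.
  exists (Num.Def.archi_bound s) => // N /= sN.
  have [|x <-] := @box_pointP R m N y Ly; last exact: psi_box.
  move=> j; apply: (@le_trans _ _ s).
    by rewrite /s (bigD1 j)//= lerDl sumr_ge0.
  by apply/ltW/(lt_le_trans (archi_boundP s0)); rewrite ler_nat.
apply: cvg_monotone_convergence => //.
by move=> N; apply: measurable_funTS.
Qed.

End lattice_integrals.

Section integrals_mu.
Context {R : realType} {m : nat}.
Import HBNNSimple.
Implicit Types q : 'rV[R]_m.+1 -> \bar R.

Lemma integral_mu q :
  measurable_fun setT q -> (forall z, 0 <= q z) ->
  \int[mu R m]_z q z =
  \int[lattice_count R m]_y \int[@lebesgue_measure R]_t q (Defs.glue (y, t)).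
Proof.
move=> mq q0.
have mqg : measurable_fun setT (q \o Defs.glue).
  by apply: measurableT_comp => //; exact: measurable_glue.
transitivity (\int[(lattice_count R m \x @lebesgue_measure R)]_p (q \o Defs.glue) p).
  have := @ge0_integral_pushforward _ _ _ _ R _ measurable_glue
    (lattice_count R m \x @lebesgue_measure R) setT q measurableT mq.
  by rewrite preimage_setT => <- // y _; exact: q0.
apply: (@fubini_tonelli1 _ _ _ _ R (@lattice_counter R m) (@lebesgue_measure R)
  _ mqg) => p.
exact: q0.
Qed.

(** The half of Tonelli's theorem that survives without measurability, obtained from the simple
    functions below [q]. *)
Lemma integral_mu_le q : (forall z, 0 <= q z) ->
  \int[mu R m]_z q z <=
  \int[lattice_count R m]_y \int[@lebesgue_measure R]_t q (Defs.glue (y, t)).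
Proof.
move=> q0; rewrite [leLHS]ge0_integralE// patch_setT.
apply: ge_ereal_sup => _ [h hq <-]; rewrite -integralT_nnsfun.
have h0 z : 0 <= (h z)%:E by rewrite lee_fin; exact: fun_ge0.
rewrite integral_mu; [|exact/measurable_EFinP|exact: h0].
apply: le_lower_integral => [y _|y _]; first exact: integral_ge0.
exact: le_lower_integral.
Qed.

Lemma glue_proj (z : 'rV[R]_m.+1) : Defs.glue (proj_hyperplane z, z ord0 ord_max) = z.
Proof.
apply/rowP => i; rewrite /Defs.glue /e_last; case: (unliftP ord_max i) => [j|] ->.
  by rewrite !mxE liftK !mxE eqxx eq_sym (negbTE (neq_lift _ _)) mulr0 addr0.
by rewrite !mxE unlift_none !eqxx mulr1 add0r.
Qed.

Lemma glueK (y : 'rV[R]_m) (t : R) :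
  proj_hyperplane (Defs.glue (y, t)) = y /\ Defs.glue (y, t) ord0 ord_max = t.
Proof.
split; last by rewrite /Defs.glue /e_last !mxE unlift_none !eqxx mulr1 add0r.
apply/rowP => j; rewrite /Defs.glue /e_last !mxE liftK eqxx eq_sym (negbTE (neq_lift _ _)).
by rewrite mulr0 addr0.
Qed.

(** The lower bound: [psi], equal to [g x] on the line over [box_point x] and zero off these
    finitely many lines, is a measurable minorant of [q], so the full Tonelli theorem applies to
    it. *)
Lemma sum_box_le_integral_mu N (q : 'rV[R]_m.+1 -> \bar R)
    (g : m.-tuple 'I_N.*2.+1 -> R -> \bar R) :
  (forall z, 0 <= q z) ->
  (forall x, measurable_fun setT (g x)) -> (forall x t, 0 <= g x t) ->
  (forall x t, g x t <= q (Defs.glue (box_point x, t))) ->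
  \sum_x \int[@lebesgue_measure R]_t g x t <= \int[mu R m]_z q z.
Proof.
move=> q0 mg g0 gq.
pose ind (x : m.-tuple 'I_N.*2.+1) (y : 'rV[R]_m) : \bar R :=
  (\1_[set box_point x] y)%:E.
have ind0 x y : 0 <= ind x y by rewrite lee_fin.
have mind x : measurable_fun setT (ind x).
  by apply/measurable_EFinP/measurable_indic; exact: measurable_rV_set1.
pose psi (z : 'rV[R]_m.+1) :=
  \sum_x g x (z ord0 ord_max) * ind x (proj_hyperplane z).
have mlast : measurable_fun setT (fun z : 'rV[R]_m.+1 => z ord0 ord_max).
  exact: (measurable_coordinate ord_max).
have mproj : measurable_fun setT (@proj_hyperplane R m).
  apply: measurable_fun_rV => i.
  rewrite (_ : _ \o _ = coordinate (lift ord_max i)).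
    exact: measurable_coordinate.
  by apply/funext => z; rewrite /= /coordinate mxE.
have mpsi : measurable_fun setT psi.
  apply: emeasurable_sum => x; apply: emeasurable_funM.
    exact: measurableT_comp (mg x) mlast.
  exact: measurableT_comp (mind x) mproj.
have psi0 z : 0 <= psi z by apply: sume_ge0 => x _; rewrite mule_ge0.
apply: (@le_trans _ _ (\int[mu R m]_z psi z)); last first.
  apply: le_lower_integral => // z _.
  have [[x _ xz]|nxz] := pselect (range (@box_point R m N) (proj_hyperplane z)).
    rewrite /psi (bigD1 x)//= /ind -xz indicE mem_set// mule1 big1 ?adde0.
      by rewrite -[in leRHS](glue_proj z) -xz.
    move=> i ix; rewrite indicE memNset ?mule0// => /box_point_inj xi.
    by rewrite xi eqxx in ix.
  rewrite /psi big1// => x _; rewrite /ind indicE memNset ?mule0//= => xz.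
  by apply: nxz; exists x.
rewrite integral_mu//.
have -> : (fun y => \int[@lebesgue_measure R]_t psi (Defs.glue (y, t))) =
    (fun y => \sum_x (\int[@lebesgue_measure R]_t g x t) * ind x y).
  apply/funext => y.
  rewrite (_ : (fun t => _) = (fun t => \sum_x g x t * ind x y)); last first.
    by apply/funext => t; rewrite /psi; have [-> ->] := glueK y t.
  rewrite ge0_integral_sum; [|by []| |by move=> x t _; rewrite mule_ge0].
    by apply: eq_bigr => x _; rewrite ge0_integralZr//; exact: mg.
  by move=> x; apply: emeasurable_funM; [exact: mg|exact: measurable_cst].
have int0 x : 0 <= \int[@lebesgue_measure R]_t g x t by exact: integral_ge0.
rewrite ge0_integral_sum; [|by []| |by move=> x y _; rewrite mule_ge0].
  apply: lee_sum => x _; rewrite ge0_integralZl//.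
  rewrite integral_indic//; last exact: measurable_rV_set1.
  by rewrite setIT lattice_count_box_point mule1.
by move=> x; apply: measurable_funeM; exact: mind.
Qed.

End integrals_mu.

(** * Summability of the projection *)

Section affine_change_of_variables.
Context {R : realType}.
Local Notation leb := (@lebesgue_measure R).

Lemma measurable_affine (c w : R) :
  measurable_fun [set: measurableTypeR R] (fun t : R => (c * t + w)%R : measurableTypeR R).
Proof. by apply: measurable_funD => //; exact: measurable_funM. Qed.

(** Uniqueness of Lebesgue measure: the rescaled image measure agrees with it on half-open
    intervals. *)
Lemma lebesgue_affine (c w : R) (E : set R) : (c != 0)%R -> measurable E ->
  leb ((fun t : R => (c * t + w)%R) @^-1` E) = (`|c|^-1)%:E * leb E.
Proof.
move=> c0 mE; have nc0 : (0 <= `|c|)%R by [].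
pose T (t : measurableTypeR R) : measurableTypeR R := (c * t + w)%R.
have mT : measurable_fun setT T by exact: measurable_affine.
pose nu : {measure set (measurableTypeR R) -> \bar R} :=
  mscale (NngNum nc0) (pushforward leb T).
have nuE : leb E = nu mT E.
  apply: lebesgue_measure_unique => //= X [[a b] _ <-] /=.
  rewrite /mscale /= /pushforward.
  rewrite lebesgue_measure_itv/= lte_fin.
  have [cp|cn|/eqP] := ltgtP 0%R c; last by rewrite eq_sym (negbTE c0).
    rewrite (_ : T @^-1` _ = `]((a - w) / c)%R, ((b - w) / c)%R]%classic); last first.
      apply/seteqP; split => t /=; rewrite !in_itv/= ltr_pdivrMr// ler_pdivlMr//.
        by rewrite ltrBlDr lerBrDr mulrC.
      by rewrite ltrBlDr lerBrDr mulrC.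
    rewrite lebesgue_measure_itv/= lte_fin ltr_pM2r ?invr_gt0// ltrD2r.
    case: ifPn => _; last by rewrite mule0.
    rewrite gtr0_norm// -!EFinB -EFinM; congr (_%:E).
    by field.
  rewrite (_ : T @^-1` _ = `[((b - w) / c)%R, ((a - w) / c)%R[%classic); last first.
    apply/seteqP; split => t /=; rewrite !in_itv/= ltr_ndivlMr// ler_ndivrMr//.
      by rewrite ltrBlDr lerBrDr mulrC andbC.
    by rewrite ltrBlDr lerBrDr mulrC andbC.
  rewrite lebesgue_measure_itv/= lte_fin ltr_nM2r ?invr_lt0// ltrD2r.
  case: ifPn => _; last by rewrite mule0.
  rewrite ltr0_norm// -!EFinB -EFinM; congr (_%:E).
  by field.
rewrite nuE /nu /= /mscale /= muleA -EFinM mulVf ?mul1e//.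
by rewrite normr_eq0.
Qed.

Lemma integral_affine (c w : R) (phi : R -> \bar R) : (c != 0)%R ->
  measurable_fun setT phi -> (forall t, 0 <= phi t) ->
  \int[leb]_t phi (c * t + w)%R = (`|c|^-1)%:E * \int[leb]_t phi t.
Proof.
move=> c0 mphi phi0; have nc0 : (0 <= `|c|^-1)%R by rewrite invr_ge0.
have mT := measurable_affine c w.
have := @ge0_integral_pushforward _ _ _ _ R _ mT leb setT phi measurableT mphi.
rewrite preimage_setT => <-; last by move=> y _; exact: phi0.
rewrite -(@ge0_integral_mscale _ _ _ leb _ measurableT (NngNum nc0))//.
by apply: eq_measure_integral => A mA _; exact: lebesgue_affine.
Qed.

(** The substitution halves the integral and the two half-lines double it, so the factor 2 of
    Steiner symmetrization leaves no constant. *)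
Lemma integral_abs_double (D : R -> \bar R) :
  measurable_fun setT (fun t : R => D `|t|%R) -> (forall t, 0 <= D t) ->
  \int[leb]_t D (2 * `|t|)%R = \int[leb]_(t in `[0%R, +oo[) D t.
Proof.
move=> mD D0.
transitivity (\int[leb]_t D `|2 * t + 0|%R).
  by apply: eq_integral => t _; rewrite addr0 normrM ger0_norm.
rewrite (@integral_affine 2 0 (fun t => D `|t|%R))//.
have mDp : measurable_fun (`[0%R, +oo[%classic : set R) D.
  apply: eq_measurable_fun (measurable_funTS mD) => t.
  by rewrite inE/= in_itv/= andbT => t0; rewrite ger0_norm.
pose Dp := D \_ (`[0%R, +oo[%classic : set R).
have mDp' : measurable_fun setT Dp by apply/(measurable_restrictT D).
have Dp0 t : 0 <= Dp t by rewrite /Dp patchE; case: ifP.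
have -> : \int[leb]_t D `|t|%R = \int[leb]_t (Dp t + Dp (-1 * t + 0)%R).
  (* At 0 the two reflected halves would count [D 0] twice, so that point is removed. *)
  rewrite [LHS](@lower_integral_setC0 _ _ _ _ (~` [set (0 : R)%R] : set (measurableTypeR R)))//.
  - rewrite [RHS](@lower_integral_setC0 _ _ _ _ (~` [set (0 : R)%R] : set (measurableTypeR R)))//.
    + apply: eq_integral => t; rewrite inE /= => /eqP t0.
      rewrite addr0 mulN1r /Dp !patchE !mem_setE !in_itv/= !andbT oppr_ge0.
      case: (ltgtP t 0%R) t0 => //= t0 _; rewrite ?adde0 ?add0e.
        by rewrite ltr0_norm.
      by rewrite gtr0_norm.
    + exact: measurableC.
    + by rewrite setCK /= lebesgue_measure_set1.
    + by move=> t; rewrite adde_ge0.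
  - exact: measurableC.
  - by rewrite setCK /= lebesgue_measure_set1.
rewrite ge0_integralD//; last first.
  by apply: (measurableT_comp mDp'); exact: measurable_affine.
rewrite (@integral_affine (-1) 0 Dp)// ?oppr_eq0//.
rewrite normrN1 invr1 mul1e ger0_norm// [in RHS]integral_mkcond.
set I := \int[leb]_t Dp t; have I0 : 0 <= I by exact: integral_ge0.
rewrite -[I in (_ * (I + _))]mul1e -[X in _ * (_ + X)]mul1e -ge0_muleDl//.
by rewrite muleA -EFinD -EFinM mulVf// mul1e.
Qed.

End affine_change_of_variables.

Section inner_approximation.
Context d (T : measurableType d) (R : realType).
Variable nu : {measure set T -> \bar R}.

Lemma outer_approximation (X : set T) (e : R) : (0 < e)%R -> mu_ext nu X < +oo ->
  exists G, [/\ measurable G, X `<=` G & nu G <= mu_ext nu X + e%:E].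
Proof.
move=> e0 Xfin; have Xf : mu_ext nu X \is a fin_num.
  by rewrite ge0_fin_numE// mu_ext_ge0.
have [_ [F [mF XF] <-] Fe] := lb_ereal_inf_adherent e0 Xf.
exists (\bigcup_k F k); split => //; first exact: bigcup_measurable.
apply: le_trans (ltW Fe).
by apply: measure_sigma_subadditive => //; exact: bigcup_measurable.
Qed.

(** Take a Borel G around E and a Borel H around G minus E, both tightly; then G minus H lies in E.
    This replaces a Lebesgue measurable superlevel set by a Borel set, to which the dilation formula
    applies. *)
Lemma inner_approximation (E : set T) :
  caratheodory_measurable (mu_ext nu) E -> 0 < mu_ext nu E -> mu_ext nu E < +oo ->
  exists F, [/\ measurable F, F `<=` E & 0 < nu F].
Proof.
move=> mE E0 Efin; have Ef : mu_ext nu E \is a fin_num.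
  by rewrite ge0_fin_numE// mu_ext_ge0.
(* A third suffices: if G minus H were null, G would have measure at most 2 e, less than that of its
   subset E. *)
pose e := (fine (mu_ext nu E) / 3)%R.
have e0 : (0 < e)%R by rewrite divr_gt0// fine_gt0// E0.
have [G [mG EG Ge]] := outer_approximation e0 Efin.
have := mE G; rewrite measurable_mu_extE// setIidr// => nuG.
have diff_le : mu_ext nu (G `&` ~` E) <= e%:E.
  by rewrite -(leeD2lE _ _ Ef) -nuG.
have [|H [mH GEH He]] := @outer_approximation (G `&` ~` E) e e0.
  exact: le_lt_trans diff_le (ltry _).
exists (G `\` H); split; first exact: measurableD.
  by move=> x [Gx nHx]; apply: contrapT => nEx; apply: nHx; exact: GEH.
rewrite ltNge; apply/negP => GH0.
have : nu G <= e%:E + e%:E.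
  have nuH : nu H <= e%:E + e%:E by apply: le_trans He _; rewrite leeD2r.
  apply: (@le_trans _ _ (nu (G `\` H) + nu H)).
    rewrite -measureU//; last 2 first.
    - exact: measurableD.
    - by rewrite setDE -setIA setICl setI0.
    apply: le_measure; rewrite ?inE//.
      by apply: measurableU => //; exact: measurableD.
    by move=> x Gx; have [Hx|nHx] := pselect (H x); [right|left].
  by apply: le_trans (leeD GH0 nuH) _; rewrite add0e.
have nuE : mu_ext nu E = (e * 3)%:E by rewrite /e divfK// fineK.
rewrite nuG nuE; apply/negP; rewrite -ltNge.
apply: (@lt_le_trans _ _ (e * 3)%:E); last by rewrite leeDl// mu_ext_ge0.
by rewrite -EFinD lte_fin; lra.
Qed.

End inner_approximation.

Section lebesgue_borel_scaling.
Context {R : realType}.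
Local Notation leb := (@lebesgue_measure R).

Lemma measurable_dilation n (w : 'rV[R]_n) :
  measurable_fun setT (fun x : 'rV[R]_n => 2 *: x - w)%R.
Proof.
apply: measurable_fun_rV => i.
rewrite (_ : _ \o _ = (fun x : 'rV[R]_n => (2 * coordinate i x + - w ord0 i)%R)).
  exact: measurableT_comp (measurable_affine _ _) (measurable_coordinate i).
by apply/funext => x; rewrite /coordinate /= !mxE.
Qed.

Lemma glue_dilation m (y : 'rV[R]_m) t (w : 'rV[R]_m.+1) :
  (2 *: Defs.glue (y, t) - w = Defs.glue (2 *: y - proj_hyperplane w,
    2 * t + - w ord0 ord_max))%R.
Proof.
rewrite -[RHS]glue_proj -[LHS]glue_proj; congr (Defs.glue (_, _)).
  have [-> _] := glueK (2 *: y - proj_hyperplane w)%R (2 * t + - w ord0 ord_max)%R.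
  have [yE _] := glueK y t.
  by apply/rowP => j; rewrite -[y in RHS]yE !mxE.
have [_ ->] := glueK (2 *: y - proj_hyperplane w)%R (2 * t + - w ord0 ord_max)%R.
have [_ tE] := glueK y t.
by rewrite -[t in RHS]tE !mxE.
Qed.

(** The preimage is (E + w) / 2. By Tonelli the last coordinate gives a factor 1 / 2, and induction
    gives the others. *)
Lemma lebesgue_borel_dilation n (w : 'rV[R]_n) (E : set 'rV[R]_n) :
  measurable E ->
  lebesgue_borel R n ((fun x : 'rV[R]_n => 2 *: x - w)%R @^-1` E) =
  (2 ^- n)%:E * lebesgue_borel R n E.
Proof.
elim: n w E => [|m IH] w E mE.
  rewrite expr0 invr1 mul1e /= /dirac !indicE; congr ((nat_of_bool _)%:R%:E).
  by apply/idP/idP; rewrite !inE /= (_ : (2 *: 0 - w)%R = 0%R)//;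
    apply/rowP => -[].
pose psi (y : 'rV[R]_m) := leb (xsection (@Defs.glue R m @^-1` E) y).
have mgE : measurable (@Defs.glue R m @^-1` E).
  by rewrite -[X in measurable X]setTI; apply: measurable_glue.
have mpsi : measurable_fun setT psi by exact: measurable_fun_xsection.
have nc0 : (0 <= (2 : R) ^- m)%R by rewrite invr_ge0 exprn_ge0.
pose S (y : 'rV[R]_m) := (2 *: y - proj_hyperplane w)%R.
have mS : measurable_fun setT S by exact: measurable_dilation.
transitivity (\int[lebesgue_borel R m]_y ((2^-1)%:E * psi (S y))).
  rewrite /= /prod_line /pushforward /product_measure1.
  apply: eq_integral => y _ /=.
  have two0 : (2 != 0 :> R)%R by [].
  rewrite /psi -[X in (X^-1)%:E](@ger0_norm R 2)//.
  rewrite -(lebesgue_affine (- w ord0 ord_max) two0).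
    congr (lebesgue_measure _); apply/seteqP; split => t;
      by rewrite /xsection /= !inE /= glue_dilation.
  exact: measurable_xsection.
rewrite ge0_integralZl//; last first.
  exact: measurableT_comp mpsi mS.
have := @ge0_integral_pushforward _ _ _ _ R _ mS (lebesgue_borel R m) setT psi
  measurableT mpsi.
rewrite preimage_setT => <-; last by [].
rewrite (_ : \int[pushforward (lebesgue_borel R m) S]_y psi y =
    \int[mscale (NngNum nc0) (lebesgue_borel R m)]_y psi y); last first.
  by apply: eq_measure_integral => A mA _; exact: IH.
rewrite ge0_integral_mscale//= muleA -EFinM -invfM -exprS.
by congr (_ * _).
Qed.

End lebesgue_borel_scaling.

Section positive_cell.

Lemma sum_disjoint_le_integral d (T : measurableType d) (R : realType)
    (nu : {measure set T -> \bar R}) (I : finType) (A : I -> set T) (c : I -> R)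
    (f : T -> \bar R) :
  (forall i, measurable (A i)) -> (forall i j x, A i x -> A j x -> i = j) ->
  (forall i, (0 <= c i)%R) -> (forall x, 0 <= f x) ->
  (forall i x, A i x -> (c i)%:E <= f x) ->
  \sum_i (c i)%:E * nu (A i) <= \int[nu]_x f x.
Proof.
move=> mA dA c0 f0 cf.
have mind i : measurable_fun setT (fun x => (\1_(A i) x)%:E : \bar R).
  by apply/measurable_EFinP; exact: measurable_indic.
have intE i : \int[nu]_x ((c i)%:E * (\1_(A i) x)%:E) = (c i)%:E * nu (A i).
  by rewrite ge0_integralZl// ?lee_fin// integral_indic// setIT.
under eq_bigr do rewrite -intE.
rewrite -ge0_integral_sum; [|by []|by move=> i; exact: measurable_funeM|
  by move=> i x _; rewrite mule_ge0// lee_fin].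
apply: le_lower_integral => x _.
  by apply: sume_ge0 => i _; rewrite mule_ge0// lee_fin.
have [[i Aix]|nA] := pselect (exists i, A i x).
  rewrite (bigD1 i)//= indicE mem_set// mule1 big1 ?adde0; first exact: cf.
  move=> j ji; rewrite indicE memNset ?mule0// => Ajx.
  by rewrite (dA _ _ _ Ajx Aix) eqxx in ji.
rewrite big1// => i _; rewrite indicE memNset ?mule0// => Aix.
by apply: nA; exists i.
Qed.

Context {R : realType}.

Definition unit_cell n (c : 'rV[int]_n) : set 'rV[R]_n :=
  [set x | forall j, Num.floor (x ord0 j) = c ord0 j].

Lemma measurable_unit_cell n (c : 'rV[int]_n) : measurable (unit_cell c).
Proof.
have -> : unit_cell c = \bigcap_(j in [set: 'I_n])
    (coordinate j @^-1` `[(c ord0 j)%:~R, (c ord0 j + 1)%:~R[%classic).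
  apply/seteqP; split => x /= cx.
    by move=> j _ /=; rewrite in_itv/= -(cx j) floor_itv.
  move=> j; have := cx j I; rewrite /= in_itv/= => xj.
  exact: floor_def.
apply: fin_bigcap_measurable => // j _.
by rewrite -[X in measurable X]setTI; exact: measurable_coordinate.
Qed.

(** The sets where f >= 1 / (k + 1) inside a unit cell are countably many and cover {f > 0}, so one
    of them is not null. *)
Lemma positive_cell n (f : 'rV[R]_n -> R) : (forall x, 0 <= f x)%R ->
  (lebesgue R n).-integrable setT (EFin \o f) ->
  0 < \int[lebesgue R n]_x (f x)%:E ->
  exists v c E, [/\ (0 < v)%R, measurable E, 0 < lebesgue_borel R n E < +oo,
    E `<=` unit_cell c & forall x, E x -> (v <= f x)%R].
Proof.
move=> f0 /integrableP[mf intf] int0.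
pose T : measurableType _ := caratheodory_type (mu_ext (lebesgue_borel R n)).
pose A (k : nat) (c : 'rV[int]_n) : set T :=
  [set x | (k.+1%:R^-1 <= f x)%R] `&` unit_cell c.
have mA k c : measurable (A k c).
  apply: measurableI; last first.
    by apply: caratheodory_measurable_mu_ext; exact: measurable_unit_cell.
  rewrite (_ : mkset _ = (EFin \o f) @^-1` `[k.+1%:R^-1%:E, +oo[%classic); last first.
    by apply/seteqP; split => x /=; rewrite in_itv/= andbT lee_fin.
  rewrite -[X in measurable X]setTI; apply: mf => //; exact: emeasurable_itv.
have intE : \int[lebesgue R n]_x `|(EFin \o f) x| = \int[lebesgue R n]_x (f x)%:E.
  by apply: eq_integral => x _; rewrite /= ger0_norm.
rewrite intE in intf.
have [k [c Akc]] : exists k c, 0 < lebesgue R n (A k c).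
  apply: contrapT => nA.
  have A0 k c : lebesgue R n (A k c) = 0.
    apply/eqP; rewrite eq_le measure_ge0 andbT leNgt; apply/negP => A0.
    by apply: nA; exists k, c.
  suff : \int[lebesgue R n]_x (f x)%:E = \int[lebesgue R n]_x (cst 0 x).
    by rewrite integral_cst// mul0e => f00; rewrite f00 ltxx in int0.
  apply: ge0_ae_eq_integral => //.
    by move=> x _; rewrite lee_fin.
  pose G (i : nat) : set T := if @unpickle (nat * 'rV[int]_n)%type i is Some p
    then A p.1 p.2 else set0.
  suff : (lebesgue R n).-negligible (~` [set x | setT x -> (f x)%:E = cst 0 x]) by [].
  apply: (@negligibleS _ _ _ (lebesgue R n) (\bigcup_i G i)); last first.
    apply: negligible_bigcup => i; rewrite /G; case: unpickle => [p|].
      by apply/negligibleP => //; exact: A0.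
    exact: negligible_set0.
  move=> x /= nfx.
  have fx : (0 < f x)%R.
    rewrite lt_neqAle f0 andbT; apply/eqP => fx; apply: nfx => _ /=.
    by rewrite -fx.
  have [k kf] : exists k, (k.+1%:R^-1 <= f x)%R.
    exists (Num.Def.archi_bound (f x)^-1).
    rewrite invf_ple ?posrE//; apply: ltW.
    have : (0 <= (f x)^-1)%R by rewrite invr_ge0.
    by move/archi_boundP/lt_le_trans; apply; rewrite ler_nat.
  pose c : 'rV[int]_n := \row_j Num.floor (x ord0 j).
  exists (pickle (k, c)) => //; rewrite /G pickleK; split => //= j.
  by rewrite mxE.
have Afin : lebesgue R n (A k c) < +oo.
  have : (k.+1%:R^-1)%:E * lebesgue R n (A k c) <= \int[lebesgue R n]_x (f x)%:E.
    (* With a single set this is Markov's inequality. *)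
    have := @sum_disjoint_le_integral _ _ R (lebesgue R n) unit (fun=> A k c)
      (fun=> (k.+1%:R^-1)%R) (EFin \o f).
    rewrite (bigD1 tt)//= big1 ?adde0; last by case.
    apply => //; first by move=> [] [].
    by move=> _ x [] /=; rewrite lee_fin.
  move=> /le_lt_trans /(_ intf).
  case: (lebesgue R n (A k c)) Akc => [r _ _|_|//]; first exact: ltry.
  by rewrite gt0_muley// lte_fin invr_gt0.
have [E [mE EA E0]] := @inner_approximation _ _ R (lebesgue_borel R n) (A k c)
  (mA k c) Akc Afin.
exists (k.+1%:R^-1)%R, c, E; split => //.
- by rewrite E0 -measurable_mu_extE// (le_lt_trans _ Afin)// le_mu_ext.
- by move=> x /EA[].
- by move=> x /EA[].
Qed.

End positive_cell.

Section projection_summable.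
Context {R : realType} {m : nat}.
Variable f : 'rV[R]_m.+1 -> R.
Hypothesis f0 : forall x, (0 <= f x)%R.
Hypothesis f_le : forall x, (f x <= f 0)%R.
Hypothesis f_mid : forall x y z, (2 *: z = x + y)%R ->
  (Num.min (f x) (f y) <= f z)%R.
Hypothesis f_int : (lebesgue R m.+1).-integrable setT (EFin \o f).
Hypothesis f_pos : 0 < \int[lebesgue R m.+1]_x (f x)%:E.

Lemma proj_fun_fin y : exists2 p : R, (0 <= p)%R & proj_fun f y = p%:E.
Proof.
have p0 : 0 <= proj_fun f y.
  apply: (@le_trans _ _ (f (to_hyperplane y + 0 *: e_last m)%R)%:E).
    by rewrite lee_fin.
  by apply: ereal_sup_ubound; exists 0%R.
have pM : proj_fun f y <= (f 0%R)%:E.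
  by apply: ge_ereal_sup => _ [l _ <-]; rewrite lee_fin.
case: (proj_fun f y) p0 pM => [p||//]; last by rewrite leye_eq.
by rewrite lee_fin => p0 _; exists p.
Qed.

(** The supremum on a line need not be attained; half of it is always reached. *)
Lemma proj_fun_half y : exists l : R,
  proj_fun f y <= (2 * f (Defs.glue (y, l)))%:E.
Proof.
have [p p0 pE] := proj_fun_fin y; rewrite pE.
have [->|pn0] := eqVneq p 0%R; first by exists 0%R; rewrite lee_fin mulr_ge0.
have pp : (0 < p)%R by rewrite lt_neqAle eq_sym pn0.
have : (p / 2)%:E < proj_fun f y by rewrite pE lte_fin; lra.
move=> /ereal_sup_gt[_ [l _ <-]]; rewrite lte_fin => pl; exists l.
by rewrite lee_fin /Defs.glue /=; lra.
Qed.

(* The sets (E + (y, l_y)) / 2, for y in Z^m, are disjoint when E lies in a unit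
   cell, and f is at least min (inf_E f) (f (y, l_y)) there. *)
Lemma integral_proj_fun_lty : \int[lattice_count R m]_y proj_fun f y < +oo.
Proof.
have [v [c [E [v0 mE /andP[E0 Efin] Ec Ev]]]] := positive_cell f0 f_int f_pos.
have [e Ee] : E !=set0.
  by apply/set0P; apply: contraTneq E0 => ->; rewrite measure0 ltxx.
have vM : (v <= f 0)%R by exact: le_trans (Ev _ Ee) (f_le e).
have M0 : (0 < f 0)%R by exact: lt_le_trans vM.
have [b bE] : exists b : R, lebesgue_borel R m.+1 E = b%:E.
  by case: (lebesgue_borel R m.+1 E) E0 Efin => // b _ _; exists b.
have b0 : (0 < b)%R by rewrite bE lte_fin in E0.
have [s sE] : exists s : R, \int[lebesgue R m.+1]_x (f x)%:E = s%:E.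
  have /integrableP[_] := f_int.
  have -> : \int[lebesgue R m.+1]_x `|(EFin \o f) x| =
      \int[lebesgue R m.+1]_x (f x)%:E.
    by apply: eq_integral => x _; rewrite /= ger0_norm.
  by case: (\int[lebesgue R m.+1]_x (f x)%:E) f_pos => // s _ _; exists s.
pose d := (2 ^- m.+1 * b)%R; have d0 : (0 < d)%R by rewrite mulr_gt0// invr_gt0 exprn_gt0.
(* The 2 comes from [proj_fun_half], f 0 / v from the lower bound (v / f 0) f(w x) on [A x], and [d]
   is the measure of each [A x]. *)
pose K := (2 * (f 0 / v) * (s / d))%R.
have bound N : \sum_x proj_fun f (@box_point R m N x) <= K%:E.
  have [l lP] := choice (fun x : m.-tuple 'I_N.*2.+1 => proj_fun_half (box_point x)).
  pose w x := Defs.glue (box_point x, l x).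
  pose A x := (fun z : 'rV[R]_m.+1 => 2 *: z - w x)%R @^-1` E.
  have mA x : measurable (A x).
    by rewrite -[X in measurable X]setTI; exact: measurable_dilation.
  have := @sum_disjoint_le_integral _ _ R (lebesgue R m.+1) _ A
    (fun x => v / f 0 * f (w x))%R (EFin \o f).
  rewrite sE => main; have {main} : \sum_x (v / f 0 * f (w x))%:E *
      lebesgue R m.+1 (A x) <= s%:E.
    apply: main.
    - by move=> x; apply: caratheodory_measurable_mu_ext; exact: mA.
    (* Off the last coordinate, 2 z - w x and 2 z - w y have the same floors and differ by integers,
       so they agree. *)
    - move=> x y z /Ec xz /Ec yz; apply: (@box_point_inj R m N).
      apply/rowP => j; have := xz (lift ord_max j).
      rewrite -(yz (lift ord_max j)).
      have wE u : w u ord0 (lift ord_max j) = box_point u ord0 j.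
        by have [/rowP/(_ j)] := glueK (box_point u) (l u); rewrite mxE.
      have entry u : (2 *: z - w u)%R ord0 (lift ord_max j) =
          (2 * z ord0 (lift ord_max j) - box_point u ord0 j)%R.
        by rewrite mxE [X in (X + _)%R]mxE [X in (_ + X)%R]mxE wE.
      rewrite !entry.
      have int_box (u : m.-tuple 'I_N.*2.+1) : (box_point u ord0 j : R) \is a Num.int.
        exact: integer_lattice_box_point.
      have /intrP[p ->] := int_box x; have /intrP[q ->] := int_box y.
      by rewrite -!rmorphN /= !floorDrz ?intr_int// !intrKfloor => /addrI /oppr_inj ->.
    - by move=> x; rewrite mulr_ge0// divr_ge0// ltW.
    - by move=> x; rewrite lee_fin.
    (* [z] is the midpoint of a point of [E], where f >= v, and of [w x]; the number (v / f 0) f(w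
       x) is below both v and f(w x). *)
    - move=> x z Axz; rewrite lee_fin.
      apply: le_trans (f_mid (_ : 2 *: z = (2 *: z - w x) + w x)%R); last first.
        by rewrite subrK.
      rewrite le_min; apply/andP; split.
        apply: le_trans (Ev _ Axz).
        by rewrite mulrAC ler_pdivrMr// ler_pM2l.
      by rewrite ler_piMl// ler_pdivrMr// mul1r.
  have lebA x : lebesgue R m.+1 (A x) = d%:E.
    rewrite /lebesgue /= /completed_measure_extension measurable_mu_extE//.
    by rewrite lebesgue_borel_dilation// bE.
  under eq_bigr do rewrite lebA -EFinM; rewrite sumEFin lee_fin.
  rewrite -mulr_suml -mulr_sumr => sum_le.
  apply: (@le_trans _ _ (\sum_x (2 * f (w x))%:E)); first exact: lee_sum.
  rewrite sumEFin lee_fin -mulr_sumr /K -mulrA ler_pM2l//.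
  rewrite -ler_pdivlMr// in sum_le.
  by rewrite -ler_pdivrMl ?divr_gt0// invf_div.
have Pf0 y : 0 <= proj_fun f y by have [p p0 ->] := proj_fun_fin y; rewrite lee_fin.
have [cvgP _] := integral_lattice_count_cvg Pf0.
rewrite -(cvg_lim _ cvgP)//; apply: (@le_lt_trans _ _ K%:E); last exact: ltry.
apply: lime_le; first by apply/cvg_ex; exists (\int[lattice_count R m]_y proj_fun f y).
exact: nearW.
Qed.

End projection_summable.

(** * The overlap function of f *)

Section overlap.
Context {R : realType} {m : nat}.
Variable f : 'rV[R]_m.+1 -> R.
Local Open Scope ring_scope.

(* For r >= 0, this is the Steiner symmetrization of f at (y, r / 2). *)
Definition overlap (y : 'rV[R]_m) (r : R) : R :=
  sup [set Num.min (f (Defs.glue (y, t + `|r|))) (f (Defs.glue (y, t))) |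
    t in [set: R]].

Definition overlap_cube (y : 'rV[R]_m) (r : R) : R :=
  sup [set overlap y' r | y' in
    [set y' : 'rV[R]_m | forall j, `|y ord0 j - y' ord0 j| < 1]].

Hypothesis f0 : forall x, 0 <= f x.
Hypothesis f_le : forall x, f x <= f 0.
Hypothesis f_lc : forall (x y : 'rV[R]_m.+1) l, 0 < l < 1 ->
  f x `^ (1 - l) * f y `^ l <= f ((1 - l) *: x + l *: y).

(** Log-concavity gives quasi-concavity, since the minimum is the product of its own powers 1 - l
    and l. *)
Lemma min_le_convex (x y : 'rV[R]_m.+1) l : 0 < l < 1 ->
  Num.min (f x) (f y) <= f ((1 - l) *: x + l *: y).
Proof.
move=> l01; apply: le_trans (f_lc x y l01); have /andP[l0 l1] := l01.
have m0 : 0 <= Num.min (f x) (f y) by rewrite le_min !f0.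
have -> : Num.min (f x) (f y) =
    Num.min (f x) (f y) `^ (1 - l) * Num.min (f x) (f y) `^ l.
  have [->|n0] := eqVneq (Num.min (f x) (f y)) 0.
    by rewrite powR0 ?mul0r// subr_eq0 gt_eqF.
  by rewrite -powRD ?subrK ?powRr1// n0 implybT.
by apply: ler_pM; rewrite ?powR_ge0//; apply: ge0_ler_powR;
  rewrite ?nnegrE ?subr_ge0 ?f0// ?ge_min ?lexx ?orbT// ltW.
Qed.

Lemma midpoint_min (x y z : 'rV[R]_m.+1) : 2 *: z = x + y ->
  Num.min (f x) (f y) <= f z.
Proof.
move=> zE; have l01 : 0 < (2^-1 : R) < 1 by apply/andP; split; lra.
rewrite (_ : z = (1 - 2^-1) *: x + 2^-1 *: y); first exact: min_le_convex.
have -> : 1 - 2^-1 = 2^-1 :> R by field.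
by rewrite -scalerDr -zE scalerA mulVf// scale1r.
Qed.

Lemma glue_convex (y0 y1 : 'rV[R]_m) (t0 t1 l : R) :
  Defs.glue ((1 - l) *: y0 + l *: y1, (1 - l) * t0 + l * t1) =
  (1 - l) *: Defs.glue (y0, t0) + l *: Defs.glue (y1, t1).
Proof.
rewrite /Defs.glue /=; apply/rowP => i; rewrite !mxE.
by case: unlift => [j|]; rewrite ?mxE; ring.
Qed.

Lemma unimodal_fiber y : unimodal (fun t => f (Defs.glue (y, t))).
Proof.
move=> a b c; rewrite le_eqVlt => /predU1P[<- _|ab]; first by rewrite ge_min lexx.
rewrite le_eqVlt => /predU1P[<-|bc]; first by rewrite ge_min lexx orbT.
have a_c : a < c by exact: lt_trans bc.
have ac : 0 < c - a by rewrite subr_gt0.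
pose l := (b - a) / (c - a).
have l01 : 0 < l < 1.
  by rewrite /l divr_gt0 ?subr_gt0// ltr_pdivrMr// mul1r ltrD2r.
rewrite (_ : Defs.glue (y, b) =
  (1 - l) *: Defs.glue (y, a) + l *: Defs.glue (y, c)).
  exact: min_le_convex.
rewrite -glue_convex -scalerDl subrK scale1r; congr (Defs.glue (_, _)).
by rewrite /l; field; rewrite gt_eqF.
Qed.

Lemma overlap_has_sup y (r : R) : has_sup
  [set Num.min (f (Defs.glue (y, t + `|r|))) (f (Defs.glue (y, t))) |
    t in [set: R]].
Proof.
split; first by exists (Num.min (f (Defs.glue (y, 0 + `|r|))) (f (Defs.glue (y, 0))));
  exists 0.
by exists (f 0) => _ [t _ <-]; rewrite ge_min f_le.
Qed.

Lemma overlap_ub y (r t : R) :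
  Num.min (f (Defs.glue (y, t + r))) (f (Defs.glue (y, t))) <= overlap y r.
Proof.
apply: sup_upper_bound; first exact: overlap_has_sup.
have [r0|r0] := leP 0 r; first by exists t => //; rewrite ger0_norm.
(* For negative [r] the pair is read from its other end. *)
by exists (t + r) => //; rewrite ltr0_norm// addrK minC.
Qed.

Lemma overlap_ge0 y r : 0 <= overlap y r.
Proof. by apply: le_trans (overlap_ub y r 0); rewrite le_min !f0. Qed.

Lemma overlap_le_max y r : overlap y r <= f 0.
Proof.
apply: ge_sup; first by have [] := overlap_has_sup y r.
by move=> _ [t _ <-]; rewrite ge_min f_le.
Qed.

Lemma overlap_nonincreasing y a b : 0 <= a -> a <= b -> overlap y b <= overlap y a.
Proof.
move=> a0 ab; apply: ge_sup; first by have [] := overlap_has_sup y b.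
move=> _ [t _ <-]; apply: le_trans (overlap_ub y a t).
have b0 : 0 <= b by exact: le_trans ab.
rewrite (ger0_norm b0) le_min [X in _ && X]ge_min lexx orbT andbT.
by rewrite minC; apply: unimodal_fiber; rewrite ?lerDl ?lerD2l.
Qed.

Lemma overlap_abs y r : overlap y `|r| = overlap y r.
Proof. by rewrite /overlap normr_id. Qed.

Lemma cube_refl (y : 'rV[R]_m) (j : 'I_m) :
  `|(y ord0 j - y ord0 j : R)| < 1.
Proof. by rewrite subrr normr0. Qed.

Lemma overlap_cube_has_sup (y : 'rV[R]_m) r : has_sup [set overlap y' r | y' in
    [set y' : 'rV[R]_m | forall j, `|y ord0 j - y' ord0 j| < 1]].
Proof.
split; first by exists (overlap y r); exists y => // j; exact: cube_refl.
by exists (f 0) => _ [y' _ <-]; exact: overlap_le_max.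
Qed.

Lemma overlap_cube_ub (y y' : 'rV[R]_m) r :
  (forall j, `|y ord0 j - y' ord0 j| < 1) -> overlap y' r <= overlap_cube y r.
Proof.
by move=> yy'; apply: sup_upper_bound; [exact: overlap_cube_has_sup|exists y'].
Qed.

Lemma overlap_le_cube y r : overlap y r <= overlap_cube y r.
Proof. by apply: overlap_cube_ub => j; exact: cube_refl. Qed.

Lemma overlap_cube_ge0 y r : 0 <= overlap_cube y r.
Proof. exact: le_trans (overlap_ge0 y r) (overlap_le_cube y r). Qed.

Lemma overlap_cube_nonincreasing y a b : 0 <= a -> a <= b ->
  overlap_cube y b <= overlap_cube y a.
Proof.
move=> a0 ab; apply: ge_sup; first by have [] := overlap_cube_has_sup y b.
move=> _ [y' yy' <-]; apply: le_trans (overlap_nonincreasing y' a0 ab) _.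
exact: overlap_cube_ub.
Qed.

Lemma overlap_cube_abs y r : overlap_cube y `|r| = overlap_cube y r.
Proof.
rewrite /overlap_cube; congr (sup _); apply/seteqP; split => _ [y' yy' <-];
  by exists y'; rewrite // overlap_abs.
Qed.

(** An even function that decreases on the half-line is unimodal; the absolute value in [overlap]
    extends it evenly for this purpose. *)
Lemma even_measurable (G : R -> R) : (forall r, G `|r| = G r) ->
  (forall a b, 0 <= a -> a <= b -> G b <= G a) -> measurable_fun setT G.
Proof.
move=> Gabs Gni; apply: unimodal_measurable => x y z xy yz.
rewrite -(Gabs x) -(Gabs y) -(Gabs z) ge_min.
have : (`|y| <= `|x|) || (`|y| <= `|z|).
  have [y0|y0] := leP 0 y.
    by rewrite (ger0_norm y0) (ger0_norm (le_trans y0 yz)) yz orbT.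
  by rewrite (ltr0_norm y0) (ltr0_norm (le_lt_trans xy y0)) lerN2 xy.
by move=> /orP[h|h]; apply/orP; [left|right]; exact: Gni.
Qed.

Lemma measurable_overlap y : measurable_fun setT (overlap y).
Proof. by apply: even_measurable; [exact: overlap_abs|exact: overlap_nonincreasing]. Qed.

Lemma measurable_overlap_cube y : measurable_fun setT (overlap_cube y).
Proof.
by apply: even_measurable; [exact: overlap_cube_abs|exact: overlap_cube_nonincreasing].
Qed.

(** Allows the two suprema in [overlap_concave] to be taken one after the other. *)
Lemma sup_powR_le (A : set R) (p k c : R) : 0 < p -> 0 <= k -> A !=set0 ->
  (forall u, A u -> 0 <= u) -> (forall u, A u -> u `^ p * k <= c) ->
  sup A `^ p * k <= c.
Proof.
move=> p0; rewrite le_eqVlt => /predU1P[<-|k0] [a Aa] A0 Ac.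
  by rewrite mulr0; have := Ac a Aa; rewrite mulr0.
have c0 : 0 <= c by apply: le_trans (Ac a Aa); rewrite mulr_ge0 ?powR_ge0// ltW.
rewrite -ler_pdivlMr//; have ck0 : 0 <= c / k by rewrite divr_ge0// ltW.
have Aub u : A u -> u <= (c / k) `^ p^-1.
  move=> Au; rewrite -[leLHS](powRr1 (A0 u Au)) -(mulfV (lt0r_neq0 p0)) powRrM.
  by apply: ge0_ler_powR; rewrite ?nnegrE ?powR_ge0 ?invr_ge0 ?(ltW p0)//
    ler_pdivlMr// Ac.
have supA : sup A <= (c / k) `^ p^-1 by apply: ge_sup => //; exists a.
have supA0 : 0 <= sup A.
  apply: le_trans (A0 a Aa) _; apply: sup_upper_bound => //; split; first by exists a.
  by exists ((c / k) `^ p^-1).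
rewrite -[leRHS]powRr1// -(mulVf (lt0r_neq0 p0)) powRrM.
by apply: ge0_ler_powR; rewrite ?nnegrE ?powR_ge0 ?(ltW p0).
Qed.

(** At distance 0 the pair over [y0] is a single point t0. Combining it with both t1 and t1 + r over
    [y1] gives two points at distance l r. *)
Lemma overlap_concave (y0 y1 : 'rV[R]_m) (l r : R) : 0 < l < 1 -> 0 <= r ->
  overlap y0 0 `^ (1 - l) * overlap y1 r `^ l <=
  overlap ((1 - l) *: y0 + l *: y1) (l * r).
Proof.
move=> l01 r0; have /andP[l0 l1] := l01; have l1' : 0 < 1 - l by rewrite subr_gt0.
have min0 y s t : 0 <= Num.min (f (Defs.glue (y, t + s))) (f (Defs.glue (y, t))).
  by rewrite le_min !f0.
apply: sup_powR_le => //; [exact: powR_ge0|by have [] := overlap_has_sup y0 0| |].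
  by move=> _ [t _ <-].
move=> _ [t0 _ <-]; rewrite mulrC; apply: sup_powR_le => //.
- exact: powR_ge0.
- by have [] := overlap_has_sup y1 r.
- by move=> _ [t _ <-].
move=> _ [t1 _ <-]; rewrite mulrC normr0 addr0 minxx (ger0_norm r0).
apply: le_trans (overlap_ub _ _ ((1 - l) * t0 + l * t1)).
have step t : Num.min (f (Defs.glue (y1, t1 + r))) (f (Defs.glue (y1, t1))) <=
      f (Defs.glue (y1, t)) ->
    f (Defs.glue (y0, t0)) `^ (1 - l) * Num.min (f (Defs.glue (y1, t1 + r)))
      (f (Defs.glue (y1, t1))) `^ l <=
    f (Defs.glue ((1 - l) *: y0 + l *: y1, (1 - l) * t0 + l * t)).
  move=> mint; rewrite glue_convex; apply: le_trans (f_lc _ _ l01).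
  apply: ler_wpM2l; first exact: powR_ge0.
  by apply: ge0_ler_powR; rewrite ?nnegrE ?(ltW l0).
rewrite le_min -addrA -mulrDr; apply/andP; split; apply: step.
  by rewrite ge_min lexx.
by rewrite ge_min lexx orbT.
Qed.

Lemma sum_overlap_concave N (l r : R) : 0 < l < 1 -> 0 <= r ->
  (\sum_x overlap (@box_point R m N x) 0) `^ (1 - l) *
  (\sum_x overlap (@box_point R m N x) r) `^ l <=
  \sum_x overlap_cube (@box_point R m N x) (l * r).
Proof.
move=> l01 r0; apply: (prekopa_leindler_tuple l01).
- by move=> x; exact: overlap_ge0.
- by move=> x; exact: overlap_ge0.
- by move=> x; exact: overlap_cube_ge0.
move=> x y z xyz; apply: le_trans (overlap_concave _ _ l01 r0) _.
apply: overlap_cube_ub => j; have := xyz j; rewrite /between !mxE.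
by congr (`|_| < 1); ring.
Qed.

End overlap.

(** * Log-concavity and Steiner symmetrization *)

Lemma log_concave_ge0 (R : realType) (V : lmodType R) (f : V -> R) :
  log_concave f -> forall x, (0 <= f x)%R.
Proof. by move=> [u [_ _ fu]] x; rewrite -lee_fin fu expeR_ge0. Qed.

(** Where [u] is infinite [f] vanishes, and so does the left-hand side, both exponents being
    positive. *)
Lemma log_concave_powR (R : realType) (V : lmodType R) (f : V -> R) :
  log_concave f -> forall (x y : V) l, (0 < l < 1)%R ->
  (f x `^ (1 - l) * f y `^ l <= f ((1 - l) *: x + l *: y))%R.
Proof.
move=> lcf x y l l01; have /andP[l0 l1] := l01.
have f0 := log_concave_ge0 lcf; case: lcf => u [uNy cu fu].
have fE z a : u z = a%:E -> f z = expR (- a).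
  by move=> uz; apply: EFin_inj; rewrite fu uz.
have f_infty z : u z = +oo -> f z = 0%R.
  by move=> uz; apply: EFin_inj; rewrite fu uz.
case ux : (u x) (uNy x) => [a| |] // _; last first.
  by rewrite (f_infty _ ux) powR0 ?mul0r// subr_eq0 gt_eqF.
case uy : (u y) (uNy y) => [b| |] // _; last first.
  by rewrite (f_infty _ uy) (@powR0 _ l) ?mulr0// gt_eqF.
have l01' : (0 <= l <= 1)%R by rewrite !ltW.
have := cu x y l l01'.
rewrite ux uy -!EFinM -EFinD.
case uz : (u ((1 - l) *: x + l *: y)%R) (uNy ((1 - l) *: x + l *: y)%R) => [c| |] // _.
rewrite lee_fin => cab; rewrite (fE _ _ ux) (fE _ _ uy) (fE _ _ uz).
by rewrite -!expRM -expRD ler_expR; lra.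
Qed.

Section steiner_bounds.
Context {R : realType} {m : nat}.
Variable f : 'rV[R]_m.+1 -> R.
Hypothesis f0 : forall x, (0 <= f x)%R.
Hypothesis fsup : supnorm f = (f 0%R)%:E.

Lemma le_supnorm x : (f x <= f 0)%R.
Proof. by rewrite -lee_fin -fsup; apply: ereal_sup_ubound; exists x. Qed.

Lemma steiner_ge0 x : 0 <= steiner f x.
Proof. by rewrite /steiner fsup mule_ge0// ?lee_fin// expeR_ge0. Qed.

(** Write the minimum as f(0) e^(-u). Both points lie in the superlevel set for [u], and half of
    their difference is |tau|, so the Steiner exponent at (y, tau) is at most [u]. *)
Lemma min_le_steiner (y : 'rV[R]_m) (t tau : R) :
  (Num.min (f (Defs.glue (y, t + 2 * `|tau|))) (f (Defs.glue (y, t))))%R%:E <=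
  steiner f (Defs.glue (y, tau)).
Proof.
set s := Num.min _ _.
have [s0|s0] := leP s 0%R; first by apply: le_trans (steiner_ge0 _); rewrite lee_fin.
have sM : (s <= f 0)%R by rewrite ge_min le_supnorm.
have M0 : (0 < f 0)%R by exact: lt_le_trans sM.
pose u := (- ln (s / f 0))%R.
have sM0 : (0 < s / f 0)%R by rewrite divr_gt0.
have u0 : (0 <= u)%R by rewrite oppr_ge0 ln_le0// ler_pdivrMr// mul1r.
have expu : expR (- u) = (s / f 0)%R by rewrite opprK lnK.
have level z : (s <= f z)%R -> superlevel f u z.
  by move=> sz; rewrite /superlevel /= fsup expu -EFinM divfK ?gt_eqF// lee_fin.
have glueE t' : Defs.glue (y, t') = (to_hyperplane y + t' *: e_last m)%R by [].
have st : steiner_set (superlevel f u) (Defs.glue (y, tau)).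
  have top : superlevel f u (Defs.glue (y, t + 2 * `|tau|)%R).
    by apply: level; rewrite ge_min lexx.
  have bot : superlevel f u (Defs.glue (y, t)).
    by apply: level; rewrite ge_min lexx orbT.
  have projy : (@proj_hyperplane R m @` superlevel f u) y.
    by exists (Defs.glue (y, t)) => //; have [] := glueK y t.
  (* The sign of [tau] decides the order of the two endpoints. *)
  have [tau0|tau0] := leP 0%R tau.
    exists y, (t + 2 * `|tau|)%R, t; split; rewrite -?glueE//.
    by congr (Defs.glue (_, _)); rewrite ger0_norm//; field.
  exists y, t, (t + 2 * `|tau|)%R; split; rewrite -?glueE//.
  by congr (Defs.glue (_, _)); rewrite ltr0_norm//; field.
have exp_le : steiner_exponent f (Defs.glue (y, tau)) <= u%:E.
  by apply: ereal_inf_lbound; exists u.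
rewrite /steiner fsup (_ : s%:E = (f 0%R)%:E * expeR (- u%:E)); last first.
  by rewrite -EFinN /= expu -EFinM mulrC divfK// gt_eqF.
by apply: lee_wpmul2l; rewrite ?lee_fin// lee_expeR leeN2.
Qed.

Lemma asplund_steiner_ge0 x :
  0 <= asplund (steiner f) (EFin \o \1_(cube m)) x.
Proof.
apply: (@le_trans _ _ (steiner f x * (EFin \o \1_(cube m)) (x - x)%R)).
  by rewrite mule_ge0// ?steiner_ge0// lee_fin.
by apply: ereal_sup_ubound; exists x.
Qed.

(** Take z = (y', tau) in the Asplund product: the remaining vector (y - y', 0) lies in the cube. *)
Lemma overlap_cube_le_asplund (y : 'rV[R]_m) (tau : R) :
  (overlap_cube f y (2 * `|tau|))%:E <=
  asplund (steiner f) (EFin \o \1_(cube m)) (Defs.glue (y, tau)).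
Proof.
have key (y' : 'rV[R]_m) t : (forall j, `|y ord0 j - y' ord0 j| < 1)%R ->
    (Num.min (f (Defs.glue (y', t + `|2 * `|tau| |))) (f (Defs.glue (y', t))))%R%:E
    <= asplund (steiner f) (EFin \o \1_(cube m)) (Defs.glue (y, tau)).
  move=> yy'; rewrite ger0_norm ?mulr_ge0//.
  apply: le_trans (min_le_steiner y' t tau) _.
  apply: ereal_sup_ubound; exists (Defs.glue (y', tau)) => //=.
  rewrite indicE mem_set ?mule1//; exists (y - y')%R.
    by move=> j; have := yy' j; rewrite ltr_norml !mxE.
  rewrite /Defs.glue /= opprD addrACA subrr addr0.
  by apply/rowP => i; rewrite !mxE; case: unlift => [j|]; rewrite ?mxE ?subr0.
have := asplund_steiner_ge0 (Defs.glue (y, tau)).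
case: (asplund _ _ _) key => [a||//] key _; last exact: leey.
rewrite lee_fin; apply: ge_sup.
  by have [] := overlap_cube_has_sup le_supnorm y (2 * `|tau|)%R.
move=> _ [y' yy' <-]; apply: ge_sup.
  by have [] := overlap_has_sup le_supnorm y' (2 * `|tau|)%R.
by move=> _ [t _ <-]; rewrite -lee_fin; exact: key.
Qed.

Lemma proj_fun_overlap (y : 'rV[R]_m) : proj_fun f y = (overlap f y 0)%:E.
Proof.
apply/eqP; rewrite eq_le; apply/andP; split.
  apply: ge_ereal_sup => _ [t _ <-]; rewrite lee_fin.
  by apply: le_trans (overlap_ub le_supnorm y 0 t); rewrite addr0 minxx.
have [p p0 pE] := proj_fun_fin f0 le_supnorm y; rewrite pE lee_fin.
apply: ge_sup; first by have [] := overlap_has_sup le_supnorm y 0.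
move=> _ [t _ <-]; rewrite normr0 addr0 minxx -lee_fin -pE.
by apply: ereal_sup_ubound; exists t.
Qed.

End steiner_bounds.

(** * Moments over boxes and their limit *)

Lemma measurable_tail_integral (R : realType) (g : R -> R) :
  (forall x, 0 <= g x)%R -> measurable_fun setT g ->
  measurable_fun [set: R] (fun r : R => \int[@lebesgue_measure R]_(x in `[r, +oo[) (g x)%:E).
Proof.
move=> g0 mg.
pose k (p : R * R) : \bar R := (g p.2 * (p.1 <= p.2)%R%:R)%:E.
have mk : measurable_fun setT k.
  apply/measurable_EFinP; apply: measurable_funM; last exact: measurable_le_bool.
  exact: measurableT_comp mg measurable_snd.
have k0 p : 0 <= k p by rewrite lee_fin mulr_ge0.
rewrite (_ : (fun r => _) = fubini_F (@lebesgue_measure R) k); last first.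
  apply/funext => r; rewrite /fubini_F [LHS]integral_mkcond; apply: eq_integral => x _.
  rewrite patchE mem_setE in_itv/= andbT /k /=.
  by case: (r <= x)%R; rewrite ?(mulr1n, mulr0n, mulr1, mulr0).
exact: measurable_fun_fubini_tonelli_F.
Qed.

Lemma lee_expe (R : realDomainType) (x y : \bar R) n :
  0 <= x -> x <= y -> x ^+ n <= y ^+ n.
Proof.
move=> x0 xy; elim: n => [|n IH]; first by rewrite !expe0.
by rewrite !expeS; apply: lee_pmul => //; exact: expe_ge0.
Qed.

Section overlap_moments.
Context {R : realType} {m : nat}.
Variable f : 'rV[R]_m.+1 -> R.
Hypothesis f0 : forall x, (0 <= f x)%R.
Hypothesis f_le : forall x, (f x <= f 0)%R.
Hypothesis f_lc : forall (x y : 'rV[R]_m.+1) l, (0 < l < 1)%R ->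
  (f x `^ (1 - l) * f y `^ l <= f ((1 - l) *: x + l *: y))%R.
Local Notation leb := (@lebesgue_measure R).

Let tail (y : 'rV[R]_m) (r : R) := \int[leb]_(s in `[r, +oo[) (overlap f y s)%:E.

Let tail0 y r : 0 <= tail y r.
Proof. by apply: integral_ge0 => s _; rewrite lee_fin overlap_ge0. Qed.

Lemma integral_min_shift_le (r : R) :
  \int[mu R m]_z (Num.min (f z) (f (z - r *: e_last m)%R))%:E <=
  \int[lattice_count R m]_y \int[leb]_(s in `[r, +oo[) (overlap f y s)%:E.
Proof.
apply: (le_trans (integral_mu_le _)).
  by move=> z; rewrite lee_fin le_min !f0.
apply: le_lower_integral => y _.
  by apply: integral_ge0 => t _; rewrite lee_fin le_min !f0.
have -> : \int[leb]_t (Num.min (f (Defs.glue (y, t)))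
      (f (Defs.glue (y, t) - r *: e_last m)%R))%:E =
    \int[leb]_t (Num.min (f (Defs.glue (y, t))) (f (Defs.glue (y, t - r)%R)))%:E.
  apply: eq_integral => t _; congr (Num.min _ (f _))%:E.
  by rewrite /Defs.glue /= scalerBl addrA.
apply: (@integral_overlap_le _ (fun t => f (Defs.glue (y, t)))) => //.
- exact: unimodal_fiber.
- exact: measurable_overlap.
- by move=> s t; exact: overlap_ub.
Qed.

(** [integral_moment] at each lattice point, then monotone convergence in N, for the lattice
    integral and for the integral in r. The limit may be infinite. *)
Lemma overlap_moment_cvg :
  (\sum_x \int[leb]_(r in `[0%R, +oo[) (r ^+ m.+1 * overlap f (@box_point R m N x) r)%:E)
    @[N --> \oo] -->
  m.+1%:R%:E * \int[leb]_(r in `[0%R, +oo[) ((r ^+ m)%:E *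
    \int[lattice_count R m]_y \int[leb]_(s in `[r, +oo[) (overlap f y s)%:E).
Proof.
pose u N r := (r ^+ m)%:E * \sum_x tail (@box_point R m N x) r.
have mtail y : measurable_fun setT (tail y).
  apply: measurable_tail_integral; last exact: measurable_overlap.
  by move=> s; exact: overlap_ge0.
have mpow : measurable_fun (`[0%R, +oo[%classic : set R) (fun r => (r ^+ m)%:E : \bar R).
  by apply/measurable_EFinP; apply: measurable_funTS; exact: measurable_funX.
have pow0 (r : R) : (0 <= r)%R -> 0 <= (r ^+ m)%:E :> \bar R.
  by move=> r0; rewrite lee_fin exprn_ge0.
have D0 (r : R) : (`[0%R, +oo[%classic : set R) r -> (0 <= r)%R.
  by rewrite /= in_itv/= andbT.
have stepE N : \sum_x \int[leb]_(r in `[0%R, +oo[)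
      (r ^+ m.+1 * overlap f (@box_point R m N x) r)%:E =
    m.+1%:R%:E * \int[leb]_(r in `[0%R, +oo[) u N r.
  have -> : \int[leb]_(r in `[0%R, +oo[) u N r = \int[leb]_(r in `[0%R, +oo[)
      \sum_x (r ^+ m)%:E * tail (@box_point R m N x) r.
    by apply: eq_integral => r _; rewrite /u ge0_sume_distrr.
  rewrite ge0_integral_sum; [|by []| |].
  - rewrite ge0_sume_distrr; last first.
      move=> x _; apply: integral_ge0 => r /D0 r0.
      by apply: mule_ge0; [exact: pow0|exact: tail0].
    apply: eq_bigr => x _; rewrite -integral_moment//.
      by move=> s; exact: overlap_ge0.
    exact: measurable_overlap.
  - move=> x; apply: emeasurable_funM => //; apply: measurable_funTS; exact: mtail.
  - by move=> x r /D0 r0; apply: mule_ge0; [exact: pow0|exact: tail0].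
rewrite (_ : (fun N => _) = (fun N => m.+1%:R%:E * \int[leb]_(r in `[0%R, +oo[) u N r));
  last by apply/funext => N; exact: stepE.
apply: cvgeZl => //.
have cvg_u r : u N r @[N --> \oo] -->
    (r ^+ m)%:E * \int[lattice_count R m]_y tail y r.
  apply: cvgeZl => //.
  by have [] := @integral_lattice_count_cvg R m (tail^~ r) (tail0^~ r).
rewrite (_ : \int[leb]_(r in `[0%R, +oo[) _ =
    \int[leb]_(r in `[0%R, +oo[) limn (u^~ r)); last first.
  by apply: eq_integral => r _; apply/esym/cvg_lim.
apply: cvg_monotone_convergence => //.
- move=> N; apply: emeasurable_funM => //; apply: emeasurable_sum => x.
  apply: measurable_funTS; exact: mtail.
- move=> N r /D0 r0; apply: mule_ge0; first exact: pow0.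
  by apply: sume_ge0 => x _; exact: tail0.
- move=> r /D0 r0 n k nk; rewrite /u lee_wpmul2l ?pow0//.
  have [_] := @integral_lattice_count_cvg R m (tail^~ r) (tail0^~ r).
  exact.
Qed.

Lemma sum_overlap_gt0 N : (0 < f 0)%R -> (0 < \sum_x overlap f (@box_point R m N x) 0)%R.
Proof.
move=> fgt0; have Nlt : (N < N.*2.+1)%N by lia.
(* The tuple (N, ..., N) encodes the origin, where [f] is positive. *)
pose x0 : m.-tuple 'I_N.*2.+1 := [tuple Ordinal Nlt | _ < m].
rewrite (bigD1 x0)//= ltr_pwDl//; last by rewrite sumr_ge0// => x _; exact: overlap_ge0.
apply: lt_le_trans (overlap_ub f_le _ 0 0).
rewrite addr0 minxx (_ : Defs.glue _ = 0%R)//.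
apply/rowP => i; rewrite /Defs.glue /= scale0r addr0 !mxE; case: unlift => // j.
by rewrite !mxE tnth_mktuple subrr.
Qed.

(** The integral of [overlap_cube] is written over the whole line at 2 |t|, the form in which the
    Asplund product dominates it. *)
Lemma box_moment_bound N (A : \bar R) : (0 < f 0)%R ->
  \sum_x \int[leb]_t (overlap_cube f (@box_point R m N x) (2 * `|t|))%:E <= A ->
  (\sum_x \int[leb]_(r in `[0%R, +oo[) (r ^+ m.+1 * overlap f (@box_point R m N x) r)%:E) *
    (\sum_x overlap f (@box_point R m N x) 0)%:E ^+ m.+1 <=
  m.+1`!%:R%:E * A ^+ m.+2.
Proof.
move=> fgt0 DA.
pose F r := (\sum_x overlap f (@box_point R m N x) r)%R.
pose D r := (\sum_x overlap_cube f (@box_point R m N x) r)%R.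
have F0 r : (0 <= F r)%R by apply: sumr_ge0 => x _; exact: overlap_ge0.
have mF : measurable_fun setT F.
  by apply: measurable_sum => x; exact: measurable_overlap.
have mD : measurable_fun setT D.
  by apply: measurable_sum => x; exact: measurable_overlap_cube.
have FD r : (0 <= r)%R -> (F r <= D r)%R.
  by move=> _; apply: ler_sum => x _; exact: overlap_le_cube.
have := moment_comparison F0 mF mD FD (sum_overlap_gt0 N fgt0)
  (fun l x l01 x0 => sum_overlap_concave f0 f_le f_lc N l01 x0) m.
have D0 (r : R) : (`[0%R, +oo[%classic : set R) r -> (0 <= r)%R.
  by rewrite /= in_itv/= andbT.
have -> : \int[leb]_(x in `[0%R, +oo[) (x ^+ m.+1 * F x)%:E =
    \sum_x \int[leb]_(r in `[0%R, +oo[) (r ^+ m.+1 * overlap f (@box_point R m N x) r)%:E.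
  rewrite -ge0_integral_sum; [|by []| |].
  - by apply: eq_integral => r _; rewrite sumEFin -mulr_sumr.
  - move=> x; apply/measurable_EFinP; apply: measurable_funTS.
    by apply: measurable_funM => //; exact: measurable_overlap.
  - by move=> x r /D0 r0; rewrite lee_fin mulr_ge0 ?exprn_ge0// overlap_ge0.
have -> : \int[leb]_(x in `[0%R, +oo[) (D x)%:E =
    \sum_x \int[leb]_t (overlap_cube f (@box_point R m N x) (2 * `|t|))%:E.
  transitivity (\sum_x \int[leb]_(r in `[0%R, +oo[)
      (overlap_cube f (@box_point R m N x) r)%:E).
    rewrite -ge0_integral_sum; [|by []| |].
    - by apply: eq_integral => r _; rewrite sumEFin.
    - move=> x; apply/measurable_EFinP; apply: measurable_funTS.
      exact: measurable_overlap_cube.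
    - by move=> x r _; rewrite lee_fin overlap_cube_ge0.
  apply: eq_bigr => x _; apply/esym.
  apply: (@integral_abs_double _ (fun r => (overlap_cube f (box_point x) r)%:E)).
    apply/measurable_EFinP.
    rewrite (_ : (fun t => _) = overlap_cube f (box_point x)).
      exact: measurable_overlap_cube.
    by apply/funext => t; rewrite /= overlap_cube_abs.
  by move=> t; rewrite lee_fin overlap_cube_ge0.
move=> main; apply: le_trans main _.
apply: lee_wpmul2l; first by rewrite lee_fin.
apply: lee_expe => //; apply: sume_ge0 => x _; apply: integral_ge0 => t _.
by rewrite lee_fin overlap_cube_ge0.
Qed.

End overlap_moments.

(** * The inequality for the full lattice *)

Theorem theorem1p1 (R : realType) (m : nat) (f : 'rV[R]_m.+1 -> R)
    (fF : integrable_log_concave f) (f0 : supnorm f = (f 0%R)%:E) :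
  (m.+1)%:R%:E *
    \int[@lebesgue_measure R]_(r in `[0%R, +oo[)
      ((r ^+ m)%:E *
        \int[mu R m]_z (Num.min (f z) (f (z - r *: e_last m)%R))%:E)
  <= (m.+1)`!%:R%:E *
    ((\int[mu R m]_x asplund (steiner f) (EFin \o \1_(cube m)) x) ^+ m.+2 /
     (\int[lattice_count R m]_y proj_fun f y) ^+ m.+1).
Proof.
have [lcf intf posf] := fF.
have fge0 := log_concave_ge0 lcf; have fle := le_supnorm f0.
have flc := log_concave_powR lcf.
have fgt0 : (0 < f 0)%R.
  rewrite lt_neqAle fge0 andbT; apply/eqP => f00.
  have : \int[lebesgue R m.+1]_x (f x)%:E = 0.
    apply: integral0_eq => x _; congr (_%:E).
    by apply/eqP; rewrite eq_le fge0 {1}f00 fle.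
  by move=> E; rewrite E ltxx in posf.
have Bfin := integral_proj_fun_lty fge0 fle (midpoint_min fge0 flc) intf posf.
set A := \int[mu R m]_x asplund (steiner f) (EFin \o \1_(cube m)) x.
have A0 : 0 <= A by apply: integral_ge0 => x _; exact: asplund_steiner_ge0.
pose X N := \sum_x \int[@lebesgue_measure R]_(r in `[0%R, +oo[)
  (r ^+ m.+1 * overlap f (@box_point R m N x) r)%:E.
pose B N := (\sum_x overlap f (@box_point R m N x) 0)%R.
have B0 N : (0 < B N)%R by exact: sum_overlap_gt0.
have XA N : X N * (B N)%:E ^+ m.+1 <= m.+1`!%:R%:E * A ^+ m.+2.
  apply: box_moment_bound => //.
  apply: (@sum_box_le_integral_mu _ _ _ _
    (fun x t => (overlap_cube f (box_point x) (2 * `|t|))%:E)).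
  - exact: asplund_steiner_ge0.
  - move=> x; apply/measurable_EFinP.
    apply: (measurableT_comp (measurable_overlap_cube fge0 fle flc (box_point x))).
    by apply: measurable_funM => //; exact: measurableT_comp.
  - by move=> x t; rewrite lee_fin overlap_cube_ge0.
  - by move=> x t; exact: overlap_cube_le_asplund.
have cvgX := overlap_moment_cvg fge0 fle flc.
have Pf0 y : 0 <= proj_fun f y.
  by rewrite (proj_fun_overlap fge0 f0) lee_fin overlap_ge0.
have [cvgB _] := integral_lattice_count_cvg Pf0.
have [b bE] : exists b, \int[lattice_count R m]_y proj_fun f y = b%:E.
  have : 0 <= \int[lattice_count R m]_y proj_fun f y by exact: integral_ge0.
  by case: (\int[lattice_count R m]_y proj_fun f y) Bfin => // b _ _; exists b.
rewrite bE in cvgB *.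
have cvgBb : B N @[N --> \oo] --> b.
  apply: cvg_trans (fine_cvg cvgB); apply: near_eq_cvg.
  apply: nearW => N /=; under eq_bigr do rewrite (proj_fun_overlap fge0 f0).
  by rewrite sumEFin.
(* Positivity of each [B N] could be lost in the limit; monotonicity gives b >= B 0 > 0, so the
   division is genuine. *)
have Bge N : (B 0%N <= B N)%R.
  rewrite -lee_fin /B -!sumEFin.
  have [_ /(_ 0%N N (leq0n N))] := integral_lattice_count_cvg Pf0.
  by under eq_bigr do rewrite (proj_fun_overlap fge0 f0);
     under [X in _ <= X]eq_bigr do rewrite (proj_fun_overlap fge0 f0).
have b0 : (0 < b)%R.
  apply: lt_le_trans (B0 0%N) _.
  by apply: (cvgr_to_ge cvgBb); exact: nearW.
apply: (@le_trans _ _ (m.+1%:R%:E * \int[@lebesgue_measure R]_(r in `[0%R, +oo[)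
    ((r ^+ m)%:E * \int[lattice_count R m]_y
      \int[@lebesgue_measure R]_(s in `[r, +oo[) (overlap f y s)%:E))).
  apply: lee_wpmul2l; first by rewrite lee_fin.
  apply: le_lower_integral => r /=; rewrite in_itv/= andbT => r0.
    rewrite mule_ge0// ?lee_fin ?exprn_ge0//; apply: integral_ge0 => z _.
    by rewrite lee_fin le_min !fge0.
  apply: lee_wpmul2l; first by rewrite lee_fin exprn_ge0.
  exact: integral_min_shift_le.
have bX0 : (0 < b ^+ m.+1)%R by rewrite exprn_gt0.
rewrite -EFin_expe inver gt_eqF//.
(* An infinite [A] makes the right-hand side infinite, because [b] is finite and positive. *)
case: A A0 XA => [a|_ _|//]; last first.
  have yX k : (+oo : \bar R) ^+ k.+1 = +oo.
    by elim: k => // k IH; rewrite expeS IH mulyy.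
  by rewrite yX gt0_mulye ?lte_fin ?invr_gt0// gt0_muley ?leey// lte_fin ltr0n fact_gt0.
rewrite lee_fin => a0 XA; rewrite -EFin_expe -!EFinM.
have cvgC : (m.+1`!%:R * (a ^+ m.+2 / B N ^+ m.+1))%R%:E @[N --> \oo] -->
    (m.+1`!%:R * (a ^+ m.+2 / b ^+ m.+1))%R%:E.
  apply: cvg_EFin; first exact: nearW.
  apply: cvgMr; apply: cvgMr; apply: cvgV; first by rewrite gt_eqF.
  exact: (cvg_comp _ _ cvgBb (@exprn_continuous R m.+1 b)).
rewrite -(cvg_lim _ cvgX)// -(cvg_lim _ cvgC)//; apply: lee_lim.
- by apply/cvg_ex; eexists; exact: cvgX.
- by apply/cvg_ex; eexists; exact: cvgC.
apply: nearW => N; have := XA N; rewrite -!EFin_expe -EFinM => XB.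
by rewrite mulrA EFinM lee_pdivlMr ?exprn_gt0.
Qed.
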